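(* Let $n \geq 0$ be an integer and let $R$ be a Gorenstein $n$-coherent ring. Then for every $k \in \{0,1,\dots,n\}$ the left Gorenstein weak global dimension $\mathrm{l.w.Ggl}_{\mathcal{FP}_k\text{-}\mathrm{Inj}(R^{\mathrm{op}})}(R)$ relative to the class $\mathcal{GF}_{\mathcal{FP}_k\text{-}\mathrm{Inj}(R^{\mathrm{op}})}$ is finite and coincides with $\mathrm{fd}(\mathcal{FP}_k\text{-}\mathrm{Inj}(R^{\mathrm{op}}))$.
   Context: $R$ is an associative ring with identity; $\mathrm{Mod}(R)$ is the category of left $R$-modules and right $R$-modules are identified with left $R^{\mathrm{op}}$-modules. For a class $\mathcal{X}$ of modules, $\mathrm{fd}(\mathcal{X}) := \sup\{\mathrm{fd}(X) : X \in \mathcal{X}\}$, where $\mathrm{fd}$ is flat dimension. For an integer $k\ge 0$, a left $R$-module $M$ is finitely $k$-presented if there is an exact sequence $P_k \to \cdots \to P_1 \to P_0 \to M \to 0$ with each $P_i$ finitely generated free; $\mathcal{FP}_k(R)$ is the class of these. A left $R$-module $E$ is $\mathcal{FP}_k$-injective if $\mathrm{Ext}^1_R(M,E)=0$ for all $M \in \mathcal{FP}_k(R)$; the class of these is $\mathcal{FP}_k\text{-}\mathrm{Inj}(R)$. The classes $\mathcal{FP}_k(R^{\mathrm{op}})$ and $\mathcal{FP}_k\text{-}\mathrm{Inj}(R^{\mathrm{op}})$ are the analogous classes of right $R$-modules. $R$ is left $n$-coherent if $\mathcal{FP}_n(R) \subseteq \mathcal{FP}_{n+1}(R)$; right $n$-coherent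 is defined analogously with $R^{\mathrm{op}}$. $R$ is Gorenstein $n$-coherent if it is left and right $n$-coherent and there is an integer $m \geq 0$ such that $\mathrm{fd}(M) \leq m$ and $\mathrm{fd}(N) \leq m$ for all $M \in \mathcal{FP}_n\text{-}\mathrm{Inj}(R)$ and $N \in \mathcal{FP}_n\text{-}\mathrm{Inj}(R^{\mathrm{op}})$. For a class $\mathcal{B}$ of right $R$-modules, $\mathcal{GF}_{\mathcal{B}}$ is the class of left $R$-modules $G \cong \mathrm{Ker}(F^0 \to F^1)$ for some exact complex $\cdots \to F_1 \to F_0 \to F^0 \to F^1 \to \cdots$ of flat left $R$-modules which remains exact after applying $B \otimes_R -$ for every $B \in \mathcal{B}$. $\mathrm{Gfd}_{\mathcal{B}}(M)$ is the least $j \geq 0$ for which there is an exact sequence $0 \to G_j \to \cdots \to G_0 \to M \to 0$ with all $G_i \in \mathcal{GF}_{\mathcal{B}}$ ($\infty$ if none exists), and $\mathrm{l.w.Ggl}_{\mathcal{B}}(R) := \sup\{\mathrm{Gfd}_{\mathcal{B}}(M) : M \in \mathrm{Mod}(R)\}$. *)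

(* Defs.v *)
From HB Require Import structures.
From mathcomp Require Import all_boot all_order all_algebra.
From mathcomp Require Import generic_quotient ring_quotient freeg.
From mathcomp Require Import boolp classical_sets constructive_ereal.

(* A left R-module is an [lmodType R]; a right R-module is an [lmodType R^c],
   where R^c is the opposite ring, so that [a *: b] stands for b a. *)

Set Implicit Arguments.
Unset Strict Implicit.
Unset Printing Implicit Defensive.

Import Order.TTheory GRing.Theory Num.Theory.
Local Open Scope ring_scope.
Local Open Scope quotient_scope.

Definition modclass (R : pzRingType) := lmodType R -> Prop.

Definition exact (A B C : zmodType) (f : A -> B) (g : B -> C) : Prop :=
  forall y : B, g y = 0 <-> exists x : A, f x = y.

Definition surjective (A B : Type) (f : A -> B) : Prop :=
  forall y : B, exists x : A, f x = y.

(* B (x)_R M is the free abelian group on B * M modulo the subgroup generated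
   by the balanced biadditive relations. *)
Section Tensor.
Variables (R : pzRingType) (B : lmodType R^c) (M : lmodType R).
Local Notation free := {freeg (B * M)}.

Variant tens_rel : free -> Prop :=
| TensDl b b' m :
    tens_rel (<< (b + b', m) >> - << (b, m) >> - << (b', m) >>)
| TensDr b m m' :
    tens_rel (<< (b, m + m') >> - << (b, m) >> - << (b, m') >>)
| TensZ (a : R) b m :
    tens_rel (<< ((a : R^c) *: b, m) >> - << (b, a *: m) >>).

Definition tens_ker : {pred free} := fun x =>
  `[< forall S : {pred free}, zmod_closed S ->
        (forall y, tens_rel y -> y \in S) -> x \in S >].

Lemma tens_ker_zmod_closed : zmod_closed tens_ker.
Proof.
split=> [|x y /asboolP kx /asboolP ky]; apply/asboolP => S cS relS.
  by case: cS.
by case: (cS) => _; apply; [exact: kx | exact: ky].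
Qed.

HB.instance Definition _ :=
  GRing.isZmodClosed.Build free tens_ker tens_ker_zmod_closed.

Definition tensor : Type := Quotient.quot tens_ker.
HB.instance Definition _ := GRing.Zmodule.on tensor.

Definition tens (b : B) (m : M) : tensor :=
  \pi_(Quotient.quot tens_ker) (<< (b, m) >> : free).

Definition balanced (A : zmodType) (phi : B -> M -> A) : Prop :=
  [/\ forall b b' m, phi (b + b') m = phi b m + phi b' m,
      forall b m m', phi b (m + m') = phi b m + phi b m'
    & forall (a : R) b m, phi ((a : R^c) *: b) m = phi b (a *: m)].

(* The map induced by [phi]; only meaningful when [phi] is balanced. *)
Definition tens_lift (A : zmodType) (phi : B -> M -> A) (t : tensor) : A :=
  fglift (fun bm => phi bm.1 bm.2 : zmodule A) (repr (t : Quotient.quot tens_ker)).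

Lemma tens_rel_ker y : tens_rel y -> y \in tens_ker.
Proof. by move=> ry; apply/asboolP => S _; apply. Qed.

Local Notation pi x := (\pi_(Quotient.quot tens_ker) x : tensor).

Lemma tens_piD (x y : free) : pi (x + y) = pi x + pi y.
Proof. exact: (Quotient.pi_add tens_ker). Qed.

Lemma tens_piB (x y : free) : pi (x - y) = pi x - pi y.
Proof.
by rewrite tens_piD; congr (_ + _); exact: (Quotient.pi_opp tens_ker).
Qed.

Lemma tens_pi_surj (t : tensor) : exists x : free, t = pi x.
Proof. by exists (repr (t : Quotient.quot tens_ker)); rewrite reprK. Qed.

Lemma tens_eq (x y : free) : x - y \in tens_ker ->
  pi x = pi y.
Proof. by move=> h; apply/eqP; rewrite piE Quotient.equivE. Qed.

Lemma tens_balanced : balanced tens.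
Proof.
split=> [b b' m|b m m'|a b m].
- rewrite /tens -tens_piD; apply: tens_eq.
  by rewrite opprD addrA; apply: tens_rel_ker; apply: TensDl.
- rewrite /tens -tens_piD; apply: tens_eq.
  by rewrite opprD addrA; apply: tens_rel_ker; apply: TensDr.
- by apply: tens_eq; apply: tens_rel_ker; apply: TensZ.
Qed.

Section Lift.
Variables (A : zmodType) (phi : B -> M -> A).
Hypothesis bphi : balanced phi.

Let L (x : free) : zmodule A := fglift (fun bm => phi bm.1 bm.2 : zmodule A) x.

Let LB x y : L (x - y) = L x - L y.
Proof. exact: lift_is_additive. Qed.

Let LU b m : L << (b, m) >> = phi b m.
Proof. by rewrite /L liftU scale1r. Qed.

Let L_ker x : x \in tens_ker -> L x = 0.
Proof.
case: bphi => phiDl phiDr phiZ.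
move/asboolP/(_ [pred x | L x == 0]) => kx; apply/eqP; apply: kx.
  split=> [|u v]; rewrite !inE; first by rewrite -(subrr 0) LB subrr.
  by move=> /eqP u0 /eqP v0; rewrite LB u0 v0 subrr.
move=> y [b b' m|b m m'|a b m]; rewrite inE !LB !LU.
- by rewrite phiDl addrAC addrK subrr.
- by rewrite phiDr addrAC addrK subrr.
- by rewrite phiZ subrr.
Qed.

Let lift_pi x : tens_lift phi (pi x) = L x.
Proof.
apply/eqP; rewrite -subr_eq0 -[X in X == 0]LB; apply/eqP/L_ker.
by rewrite Quotient.idealrBE reprK.
Qed.

Lemma tens_liftE b m : tens_lift phi (tens b m) = phi b m.
Proof. by rewrite lift_pi LU. Qed.

Lemma tens_lift_additive : zmod_morphism (tens_lift phi).
Proof.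
move=> x y; have [u ->] := tens_pi_surj x; have [v ->] := tens_pi_surj y.
by rewrite -tens_piB !lift_pi LB.
Qed.

End Lift.

End Tensor.

Definition tens_map (R : pzRingType) (B B' : lmodType R^c) (M M' : lmodType R)
    (g : B -> B') (f : M -> M') : tensor B M -> tensor B' M' :=
  tens_lift (fun b m => tens (g b) (f m)).

Section TensorMap.
Variables (R : pzRingType) (B B' : lmodType R^c) (M M' : lmodType R).
Variables (g : {linear B -> B'}) (f : {linear M -> M'}).

Lemma tens_map_balanced : balanced (fun b m => tens (g b) (f m)).
Proof.
have [tDl tDr tZ] := tens_balanced B' M'.
split=> [b b' m|b m m'|a b m]; first by rewrite linearD tDl.
  by rewrite linearD tDr.
by rewrite [g (_ *: _)]linearZ_LR [f (_ *: _)]linearZ_LR tZ.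
Qed.

Lemma tens_mapE b m : tens_map g f (tens b m) = tens (g b) (f m).
Proof. exact/tens_liftE/tens_map_balanced. Qed.

Lemma tens_map_additive : zmod_morphism (tens_map g f).
Proof. exact/tens_lift_additive/tens_map_balanced. Qed.

End TensorMap.

Section Dimension.
Local Open Scope classical_set_scope.

(* Dimensions take values in N with +oo adjoined, inside [\bar int];
   [dim_infP] and [dim_supP] show that the defaults given to [infimum] and
   [supremum] do no harm. *)
Definition dim_inf (P : nat -> Prop) : \bar int :=
  infimum +oo%E [set (Posz j)%:E%E | j in [set j | P j]].

Definition dim_sup (R : pzRingType) (dim : lmodType R -> \bar int)
    (X : modclass R) : \bar int :=
  supremum 0%E [set d | exists2 M, X M & d = dim M].

Lemma dim_infP (P : nat -> Prop) :
  (exists j, [/\ P j, forall i, P i -> (j <= i)%N & dim_inf P = (Posz j)%:E%E])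
  \/ (forall j, ~ P j) /\ dim_inf P = +oo%E.
Proof.
have [[j0 Pj0]|nP] := pselect (exists j, P j); last first.
  right; split=> [j Pj|]; first by apply: nP; exists j.
  rewrite /dim_inf /infimum ifT //; apply/eqP; rewrite -subset0 => x [j Pj].
  by case: nP; exists j.
have exP : exists j, `[< P j >] by exists j0; apply/asboolP.
have [j /asboolP Pj minj] := ex_minnP exP.
have {}minj i : P i -> (j <= i)%N by move=> Pi; apply/minj/asboolP.
left; exists j; split=> //; rewrite /dim_inf /infimum ifF; last first.
  by apply/eqP => /seteqP[/(_ (Posz j)%:E%E) + _]; apply; exists j.
have Ij : infimums [set (Posz i)%:E%E | i in [set i | P i]] (Posz j)%:E%E.
  split=> [_ [i Pi <-]|y]; first by rewrite lee_fin lez_nat minj.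
  by apply; exists j.
exact/xget_subset1/is_subset1_infimums.
Qed.

Lemma dim_inf_le (P : nat -> Prop) (j : nat) :
  (dim_inf P <= (Posz j)%:E)%E <-> exists2 i, (i <= j)%N & P i.
Proof.
have [[i [Pi mini ->]]|[nP ->]] := dim_infP P.
  rewrite lee_fin lez_nat; split=> [ij|[l lj /mini il]]; first by exists i.
  exact: leq_trans il lj.
by split=> [|[i _ /nP]].
Qed.

Lemma dim_supP (R : pzRingType) (dim : lmodType R -> \bar int) (X : modclass R) :
  (exists M, X M) -> (forall M, (0 <= dim M)%E) ->
  (forall M, X M -> (dim M <= dim_sup dim X)%E) /\
  (forall y, (forall M, X M -> (dim M <= y)%E) -> (dim_sup dim X <= y)%E).
Proof.
move=> [M0 XM0] dim0; pose D := [set d | exists2 M, X M & d = dim M].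
suff [s Ds] : supremums D !=set0.
  have -> : dim_sup dim X = s.
    rewrite /dim_sup /supremum -/D ifF; last first.
      by apply/eqP => /seteqP[/(_ (dim M0)) + _]; apply; exists M0.
    exact/xget_subset1/is_subset1_supremums.
  case: Ds => ub lub; split=> [M XM|y yub]; first by apply: ub; exists M.
  by apply: lub => _ [M XM ->]; apply: yub.
have [[j0 bj0]|nb] := pselect (exists j : nat, ubound D (Posz j)%:E%E); last first.
  exists +oo%E; split=> [d _|y yub].
  exact: (@leey int).
  case: y yub => [y yub||/(_ (dim M0))] //; last first.
    move/(_ (ex_intro2 _ _ M0 XM0 erefl)); rewrite leeNy_eq => /eqP h.
    by have := dim0 M0; rewrite h.
  case: nb; exists `|y|%N => d /yub dy; apply: (le_trans dy).
  by rewrite lee_fin abszE ler_norm.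
have exb : exists j : nat, `[< ubound D (Posz j)%:E%E >].
  by exists j0; apply/asboolP.
have [j /asboolP bj minj] := ex_minnP exb; exists (Posz j)%:E%E; split=> // y yub.
have y0 : (0 <= y)%E by apply: (le_trans (dim0 M0)); apply: yub; exists M0.
case: y y0 yub => [[y|y]||] y0 yub; [|by move: y0; rewrite lee_fin|exact: (@leey int)|by move: y0; rewrite leNgt ltNy0].
by rewrite lee_fin lez_nat; apply/minj/asboolP.
Qed.

End Dimension.

(* An exact sequence 0 -> G_j -> ... -> G_0 -> M -> 0 with all G_i in C is
   extended by zero modules in degrees i > j. *)
Definition has_resolution (R : pzRingType) (C : modclass R) (j : nat)
    (M : lmodType R) : Prop :=
  exists (G : nat -> lmodType R) (d : forall i, {linear G i.+1 -> G i})
         (e : {linear G 0 -> M}),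
    [/\ surjective e, exact (d 0) e, forall i, exact (d i.+1) (d i),
        forall i, (i <= j)%N -> C (G i)
      & forall i, (j < i)%N -> forall x : G i, x = 0].

Definition resdim (R : pzRingType) (C : modclass R) (M : lmodType R) : \bar int :=
  dim_inf (fun j => has_resolution C j M).

Definition flat_left (R : pzRingType) : modclass R := fun M =>
  forall (B B' : lmodType R^c) (g : {linear B -> B'}),
    injective g -> injective (tens_map g (@idfun M)).

Definition flat_right (R : pzRingType) : modclass R^c := fun B =>
  forall (M M' : lmodType R) (f : {linear M -> M'}),
    injective f -> injective (tens_map (@idfun B) f).

Definition fd_left (R : pzRingType) : lmodType R -> \bar int :=
  resdim (@flat_left R).

Definition fd_right (R : pzRingType) : lmodType R^c -> \bar int :=
  resdim (@flat_right R).

Definition fg_free (R : pzRingType) : modclass R := fun P =>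
  exists (r : nat) (f : {linear 'rV[R]_r -> P}), bijective f.

(* The terms P i with i > k, and the maps between them, are irrelevant. *)
Definition FP (R : pzRingType) (k : nat) : modclass R := fun M =>
  exists (P : nat -> lmodType R) (d : forall i, {linear P i.+1 -> P i})
         (e : {linear P 0 -> M}),
    [/\ forall i, (i <= k)%N -> fg_free (P i), surjective e,
        (0 < k)%N -> exact (d 0) e
      & forall i, (i.+1 < k)%N -> exact (d i.+1) (d i)].

Definition projective (R : pzRingType) : modclass R := fun P =>
  forall (A B : lmodType R) (g : {linear A -> B}) (f : {linear P -> B}),
    surjective g -> exists h : {linear P -> A}, forall x, g (h x) = f x.

Definition projective_resolution (R : pzRingType) (M : lmodType R)
    (P : nat -> lmodType R) (d : forall i, {linear P i.+1 -> P i})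
    (e : {linear P 0 -> M}) : Prop :=
  [/\ forall i, projective (P i), surjective e, exact (d 0) e
    & forall i, exact (d i.+1) (d i)].

(* Ext^1_R(M, E) = 0, i.e. Hom(P_0, E) -> Hom(P_1, E) -> Hom(P_2, E) is exact
   in the middle for the projective resolutions P of M. *)
Definition Ext1_eq0 (R : pzRingType) (M E : lmodType R) : Prop :=
  forall (P : nat -> lmodType R) (d : forall i, {linear P i.+1 -> P i})
         (e : {linear P 0 -> M}),
    projective_resolution d e ->
    forall f : {linear P 1 -> E}, (forall x, f (d 1 x) = 0) ->
    exists g : {linear P 0 -> E}, forall x, g (d 0 x) = f x.

Definition FPinj (R : pzRingType) (k : nat) : modclass R := fun E =>
  forall M, FP k M -> Ext1_eq0 M E.

Definition left_coherent (R : pzRingType) (n : nat) : Prop :=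
  forall M : lmodType R, FP n M -> FP n.+1 M.

Definition right_coherent (R : pzRingType) (n : nat) : Prop :=
  left_coherent R^c n.

Definition gorenstein_coherent (R : pzRingType) (n : nat) : Prop :=
  [/\ left_coherent R n, right_coherent R n
    & exists m : nat,
        (forall M : lmodType R, FPinj n M -> (fd_left M <= (Posz m)%:E)%E) /\
        (forall N : lmodType R^c, FPinj n N -> (fd_right N <= (Posz m)%:E)%E)].

(* Exactness of ... -> Fl 1 -> Fl 0 -> Fr 0 -> Fr 1 -> ... *)
Definition acyclic (Fl Fr : nat -> zmodType) (dl : forall i, Fl i.+1 -> Fl i)
    (d : Fl 0 -> Fr 0) (dr : forall i, Fr i -> Fr i.+1) : Prop :=
  [/\ forall i, exact (dl i.+1) (dl i), exact (dl 0) d, exact d (dr 0)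
    & forall i, exact (dr i) (dr i.+1)].

(* The last clause says that [iota] identifies G with Ker (Fr 0 -> Fr 1). *)
Definition GF (R : pzRingType) (BB : modclass R^c) : modclass R := fun G =>
  exists (Fl Fr : nat -> lmodType R)
         (dl : forall i, {linear Fl i.+1 -> Fl i}) (d : {linear Fl 0 -> Fr 0})
         (dr : forall i, {linear Fr i -> Fr i.+1}),
    [/\ forall i, flat_left (Fl i) /\ flat_left (Fr i),
        acyclic dl d dr,
        forall B, BB B ->
          acyclic (fun i => tens_map (@idfun B) (dl i)) (tens_map (@idfun B) d)
                  (fun i => tens_map (@idfun B) (dr i))
      & exists iota : {linear G -> Fr 0}, injective iota /\ exact iota (dr 0)].

Definition Gfd (R : pzRingType) (BB : modclass R^c) : lmodType R -> \bar int :=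
  resdim (GF BB).

Definition lwGgl (R : pzRingType) (BB : modclass R^c) : \bar int :=
  dim_sup (Gfd BB) (fun _ => True).

(* Main.v *)
Require Import Defs.
From HB Require Import structures.
From mathcomp Require Import all_boot all_order all_algebra.
From mathcomp Require Import generic_quotient ring_quotient freeg.
From mathcomp Require Import boolp classical_sets functions constructive_ereal.

(** Write BB for the right FP_k-injective modules and s for their flat
    dimension. Every FP_k-injective module is FP_n-injective because k <= n
    ([FPinj_mono]), so s is at most the bound m of the Gorenstein condition.

    No Tor groups are constructed. What is used is the vanishing of Tor_1(B, M),
    read as injectivity of the tensored inclusion of a free syzygy of M, and
    Tor_(j+1)(B, M) = 0 is read as the vanishing of Tor_1(B, Om^j M), where Om
    denotes the free syzygy. Tor_1 may be computed from any flat presentation of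
    either argument ([tor1_left], [tor1_right]), and dimension can be shifted from
    one argument to the other ([tor1_shift]). Hence fd B <= j means
    Tor_(j+1)(B, M) = 0 for all M ([fd_right_tor]).

    Upper bound: for every M the s-th syzygy of M is Gorenstein flat relative to
    BB. Embed M in an injective module I with cokernel C. Since I is
    FP_n-injective, its flat dimension is at most m, and in fact at most s
    ([fd_left_injective]): if Om^(j+1) I is flat and j >= s, then
    Tor_1(E, Om^j I) = 0 for every injective right module E, and as every right
    module embeds in such an E, the module Om^j I is already flat. By the horseshoe
    lemma an s-th syzygy K of M then embeds in a flat module, namely an s-th
    syzygy of I, with cokernel an s-th syzygy of C. This can be repeated for ever
    to the right, and the free resolution of K continues to the left. All kernels
    in the resulting complex are s-th syzygies, so Tor_1(B, -) vanishes on them for B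
    in BB, and the complex stays exact after tensoring ([GF_coind], [syzygy_GF]).

    Lower bound: the left half of a complex defining a Gorenstein flat module G
    is a flat resolution that stays exact under B (x) -, so all Tor_i(B, G) with
    i >= 1 vanish ([left_GF_tor]). If every M has a resolution of length d by such
    modules, dimension shifting gives Tor_(d+1)(B, M) = 0 for all M
    ([res_GF_tor]), that is fd B <= d. *)

Set Implicit Arguments.
Unset Strict Implicit.
Unset Printing Implicit Defensive.

Import Order.TTheory GRing.Theory Num.Theory.
Local Open Scope ring_scope.
Local Open Scope quotient_scope.

(** * Submodules, quotients and free modules *)

Definition ses (A B C : zmodType) (f : A -> B) (g : B -> C) : Prop :=
  [/\ injective f, exact f g & surjective g].

Lemma inj_ker (A B : zmodType) (f : A -> B) : zmod_morphism f ->
  (forall x, f x = 0 -> x = 0) -> injective f.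
Proof. by move=> fB f0 x y fxy; apply/subr0_eq/f0; rewrite fB fxy subrr. Qed.

(** The universal property of a kernel, and, with [i] an isomorphism and [g] the
    identity, the linearity of the inverse. *)
Lemma linear_lift (R : pzRingType) (L M N : lmodType R) (i : {linear M -> N})
    (g : {linear L -> N}) : injective i -> (forall x, exists y, i y = g x) ->
  exists h : {linear L -> M}, forall x, i (h x) = g x.
Proof.
move=> ii gi; pose h x := projT1 (cid (gi x)).
have hE x : i (h x) = g x by rewrite /h; case: cid.
have hl : linear h by move=> a u v; apply: ii; rewrite linearP !hE linearP.
pose hL := GRing.isLinear.Build R L M *:%R h hl.
by exists (HB.pack h hL : {linear L -> M}).
Qed.

Section Kernel.
Variables (R : pzRingType) (M N : lmodType R) (f : {linear M -> N}).

Definition ker_pred : {pred M} := fun x => f x == 0.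

Lemma ker_pred_submod : submod_closed ker_pred.
Proof.
split=> [|a u v /eqP fu /eqP fv]; apply/eqP; first exact: linear0.
by rewrite linearP fu fv scaler0 addr0.
Qed.
HB.instance Definition _ := GRing.isSubmodClosed.Build R M ker_pred ker_pred_submod.

Definition ker : Type := {x : M | x \in ker_pred}.
HB.instance Definition _ := [isSub of ker for @sval _ _].
HB.instance Definition _ := [Choice of ker by <:].
HB.instance Definition _ := [SubChoice_isSubLmodule of ker by <:].

Definition ker_in (x : ker) : M := \val x.
Fact ker_in_linear : linear ker_in. Proof. by []. Qed.
HB.instance Definition _ := GRing.isLinear.Build R ker M *:%R ker_in ker_in_linear.

Lemma ker_in_inj : injective ker_in. Proof. exact: val_inj. Qed.

Lemma ker_in_exact : exact ker_in f.
Proof.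
move=> y; split=> [fy|[x <-]]; last by apply/eqP; exact: (valP x).
by move/eqP: fy => fy; exists (Sub y fy); rewrite /ker_in SubK.
Qed.

End Kernel.

Section Cokernel.
Variables (R : pzRingType) (L M : lmodType R) (f : {linear L -> M}).

(** The image is kept as a predicate on the codomain, so that the group structure
    of the quotient is found by inference and only scaling remains to be
    defined, through representatives. *)
Definition im_pred : {pred M} := fun y => `[< exists x, f x = y >].

Lemma im_pred_closed : zmod_closed im_pred.
Proof.
split=> [|u v /asboolP[x <-] /asboolP[y <-]]; apply/asboolP.
  by exists 0; rewrite linear0.
by exists (x - y); rewrite linearB.
Qed.
HB.instance Definition _ := GRing.isZmodClosed.Build M im_pred im_pred_closed.

Definition coker : Type := Quotient.quot im_pred.
HB.instance Definition _ := GRing.Zmodule.on coker.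

Definition coker_pi (x : M) : coker := \pi_(Quotient.quot im_pred) x.

Lemma coker_piB : zmod_morphism coker_pi.
Proof. exact: (@pi_is_zmod_morphism _ _ _ (Quotient.quot im_pred)). Qed.

Lemma coker_pi_eq0 x : (coker_pi x = 0) <-> (x \in im_pred).
Proof.
have <- : coker_pi 0 = 0 by have := coker_piB 0 0; rewrite !subrr.
by rewrite /coker_pi -{2}(subr0 x) Quotient.idealrBE; split=> [/eqP|/eqP].
Qed.

Lemma coker_pi_surj : surjective coker_pi.
Proof. by move=> y; exists (repr (y : Quotient.quot im_pred)); rewrite /coker_pi reprK. Qed.

Definition coker_scale (a : R) (x : coker) : coker :=
  coker_pi (a *: repr (x : Quotient.quot im_pred)).

Lemma coker_scaleE a x : coker_scale a (coker_pi x) = coker_pi (a *: x).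
Proof.
apply/subr0_eq; rewrite /coker_scale -coker_piB -scalerBr; apply/coker_pi_eq0.
have /asboolP[y yE] : repr (coker_pi x : Quotient.quot im_pred) - x \in im_pred.
  by rewrite Quotient.idealrBE reprK.
by apply/asboolP; exists (a *: y); rewrite linearZ yE.
Qed.

Fact coker_piD x y : coker_pi (x + y) = coker_pi x + coker_pi y.
Proof. by apply/eqP; rewrite -subr_eq -coker_piB addrK. Qed.

Fact coker_scaleA a b x : coker_scale a (coker_scale b x) = coker_scale (a * b) x.
Proof. by have [y <-] := coker_pi_surj x; rewrite !coker_scaleE scalerA. Qed.
Fact coker_scale1 : left_id 1 coker_scale.
Proof. by move=> x; have [y <-] := coker_pi_surj x; rewrite coker_scaleE scale1r. Qed.
Fact coker_scaleDr : right_distributive coker_scale +%R.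
Proof.
move=> a x x'; have [y <-] := coker_pi_surj x; have [y' <-] := coker_pi_surj x'.
by rewrite -coker_piD !coker_scaleE scalerDr coker_piD.
Qed.
Fact coker_scaleDl x : {morph coker_scale^~ x : a b / a + b}.
Proof.
by move=> a b; have [y <-] := coker_pi_surj x; rewrite !coker_scaleE scalerDl coker_piD.
Qed.
HB.instance Definition _ := GRing.Zmodule_isLmodule.Build R coker
  coker_scaleA coker_scale1 coker_scaleDr coker_scaleDl.

Fact coker_pi_linear : linear coker_pi.
Proof. by move=> a u v; rewrite coker_piD -coker_scaleE. Qed.
HB.instance Definition _ := GRing.isLinear.Build R M coker *:%R coker_pi coker_pi_linear.

Lemma coker_exact : exact f coker_pi.
Proof.
by move=> y; split=> [/coker_pi_eq0/asboolP|?]; last by apply/coker_pi_eq0/asboolP.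
Qed.

Lemma coker_ses : injective f -> ses f coker_pi.
Proof. by move=> fi; split; [ | exact: coker_exact | exact: coker_pi_surj]. Qed.

End Cokernel.

Section ZQuotient.
Variables (A : zmodType) (P : A -> Prop).

(** The subgroup generated by [P]. It is closed under subtraction whatever [P]
    is, which lets the quotient by it be formed before [P] is known to be a
    subgroup. *)
Definition zspan : {pred A} := fun x =>
  `[< forall S : {pred A}, zmod_closed S -> (forall y, P y -> y \in S) -> x \in S >].

Lemma zspan_closed : zmod_closed zspan.
Proof.
split=> [|x y /asboolP kx /asboolP ky]; apply/asboolP => S cS relS.
  by case: cS.
by case: (cS) => _; apply; [exact: kx | exact: ky].
Qed.
HB.instance Definition _ := GRing.isZmodClosed.Build A zspan zspan_closed.

Lemma zquot_exists : P 0 -> (forall x y, P x -> P y -> P (x - y)) ->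
  exists (Q : zmodType) (p : A -> Q),
  [/\ zmod_morphism p, surjective p & forall x, p x = 0 <-> P x].
Proof.
move=> P0 PB; exists (Quotient.quot zspan), \pi_(Quotient.quot zspan).
have piB : zmod_morphism (\pi_(Quotient.quot zspan) : A -> _).
  exact: (@pi_is_zmod_morphism _ _ _ (Quotient.quot zspan)).
split=> // [y|x]; first by exists (repr y); rewrite reprK.
have <- : \pi_(Quotient.quot zspan) 0 = 0 by have := piB 0 0; rewrite !subrr.
split=> [/eqP|Px]; last first.
  by apply/eqP; rewrite -Quotient.idealrBE subr0; apply/asboolP => S _; apply.
rewrite -Quotient.idealrBE subr0 => /asboolP/(_ (fun x => `[< P x >])) h.
apply/asboolP/h => [|y Py]; last exact/asboolP.
by split=> [|u v /asboolP Pu /asboolP Pv]; apply/asboolP; [|exact: PB].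
Qed.
End ZQuotient.

Section Free.
Variables (R : pzRingType) (X : choiceType).

(** Functions of finite support rather than formal sums: equality is then checked on
    coordinates, and coordinates are what makes these modules flat. *)
Definition fin_supp : {pred X -> R^o} := fun f =>
  `[< exists s : seq X, forall x, x \notin s -> f x = 0 >].

Lemma fin_supp_submod : submod_closed fin_supp.
Proof.
split=> [|a u v]; first by apply/asboolP; exists [::].
move=> /asboolP[s us] /asboolP[t vt]; apply/asboolP; exists (s ++ t) => x.
rewrite mem_cat negb_or => /andP[xs xt].
have -> : (a *: u + v) x = a * u x + v x by [].
by rewrite us // vt // mulr0 addr0.
Qed.
HB.instance Definition _ :=
  GRing.isSubmodClosed.Build R (X -> R^o) fin_supp fin_supp_submod.

Definition freemod : Type := {f : X -> R^o | f \in fin_supp}.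
HB.instance Definition _ := [isSub of freemod for @sval _ _].
HB.instance Definition _ := [Choice of freemod by <:].
HB.instance Definition _ := [SubChoice_isSubLmodule of freemod by <:].

Definition fcoord (f : freemod) (x : X) : R := \val f x.

Lemma fcoordP a (f g : freemod) x : fcoord (a *: f + g) x = a * fcoord f x + fcoord g x.
Proof. by []. Qed.

Lemma fcoordB (f g : freemod) x : fcoord (f - g) x = fcoord f x - fcoord g x.
Proof. by []. Qed.

Lemma fcoord_inj f g : fcoord f =1 fcoord g -> f = g.
Proof. by move=> fg; apply/val_inj/funext. Qed.

Lemma supp_exists (f : freemod) : exists s : seq X, forall x, x \notin s -> fcoord f x = 0.
Proof. by have /asboolP[s fs] := valP f; exists s. Qed.

Definition supp (f : freemod) : seq X := undup (projT1 (cid (supp_exists f))).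

Lemma supp_uniq f : uniq (supp f). Proof. exact: undup_uniq. Qed.

Lemma suppP f x : x \notin supp f -> fcoord f x = 0.
Proof. by rewrite /supp mem_undup; case: cid => s /=; apply. Qed.

Lemma delta_supp (x : X) : (fun y => (y == x)%:R : R^o) \in fin_supp.
Proof. by apply/asboolP; exists [:: x] => y; rewrite inE => /negPf->. Qed.

Definition delta (x : X) : freemod :=
  exist (fun f => f \in fin_supp) (fun y => (y == x)%:R) (delta_supp x).

Lemma fcoord_delta x y : fcoord (delta x) y = (y == x)%:R.
Proof. by []. Qed.

Section Eval.
Variables (M : lmodType R) (phi : X -> M).

Definition free_map (f : freemod) : M := \sum_(x <- supp f) fcoord f x *: phi x.

(** The value of the sum does not depend on the chosen support, so that two
    functions can be compared on a common list of indices. *)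
Lemma free_mapE (f : freemod) (s : seq X) : uniq s -> {subset supp f <= s} ->
  free_map f = \sum_(x <- s) fcoord f x *: phi x.
Proof.
move=> us ss; rewrite /free_map (bigID (fun x => x \in supp f) predT) /=.
rewrite [X in _ + X]big1 ?addr0 => [|x /suppP ->]; last by rewrite scale0r.
rewrite [RHS](bigID (fun x => x \in supp f)) /=.
rewrite [X in _ = _ + X]big1 ?addr0 => [|x /suppP ->]; last by rewrite scale0r.
rewrite -[LHS]big_filter -[RHS]big_filter; apply: perm_big; apply: uniq_perm.
- exact/filter_uniq/supp_uniq.
- exact/filter_uniq.
by move=> x; rewrite !mem_filter andbb; case: (boolP (x \in supp f)) => //= xs; rewrite (ss x xs).
Qed.

Lemma free_map_linear : linear free_map.
Proof.
move=> a f g; pose s := undup (supp f ++ supp g ++ supp (a *: f + g)).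
have us : uniq s by exact: undup_uniq.
rewrite (free_mapE (f := a *: f + g) us) => [|x xs]; last first.
  by rewrite mem_undup !mem_cat xs !orbT.
rewrite (free_mapE (f := f) us) => [|x xs]; last by rewrite mem_undup !mem_cat xs.
rewrite (free_mapE (f := g) us) => [|x xs]; last first.
  by rewrite mem_undup !mem_cat xs orbT.
rewrite scaler_sumr -big_split; apply: eq_bigr => x _.
by rewrite fcoordP scalerDl scalerA.
Qed.
HB.instance Definition _ := GRing.isLinear.Build R freemod M *:%R free_map free_map_linear.

Lemma free_map_delta x : free_map (delta x) = phi x.
Proof.
rewrite (free_mapE (s := undup (x :: supp (delta x)))) ?undup_uniq // => [|y ys].
  rewrite (bigD1_seq x) ?undup_uniq ?mem_undup ?mem_head //= fcoord_delta eqxx scale1r.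
  by rewrite big1 ?addr0 // => y /negPf yx; rewrite fcoord_delta yx scale0r.
by rewrite mem_undup inE ys orbT.
Qed.
End Eval.

Lemma free_decomp (f : freemod) (s : seq X) : uniq s -> {subset supp f <= s} ->
  f = \sum_(x <- s) fcoord f x *: delta x.
Proof.
move=> us ss; apply: fcoord_inj => y.
have sumE (t : seq X) : fcoord (\sum_(x <- t) fcoord f x *: delta x) y =
    \sum_(x <- t) fcoord f x * (y == x)%:R.
  elim: t => [|z t IH]; rewrite ?big_nil // !big_cons fcoordP -IH.
  by rewrite fcoord_delta.
rewrite sumE; case: (boolP (y \in s)) => [ys|yNs].
  rewrite (bigD1_seq y) //= eqxx mulr1 big1 ?addr0 // => x /negPf.
  by rewrite eq_sym => ->; rewrite mulr0.
rewrite suppP; last by apply: contra yNs => /ss.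
rewrite big_seq big1 // => x xs.
by case: eqP xs yNs => [->->|_ _ _] //; rewrite mulr0.
Qed.

Lemma free_map_unique (M : lmodType R) (u v : {linear freemod -> M}) :
  (forall x, u (delta x) = v (delta x)) -> u =1 v.
Proof.
move=> uv f; rewrite (free_decomp (supp_uniq f) (fun _ => id)) !linear_sum.
by apply: eq_bigr => x _; rewrite !linearZ_LR uv.
Qed.

Lemma free_projective : projective freemod.
Proof.
move=> A B g f gs.
pose phi x := projT1 (cid (gs (f (delta x)))).
have phiE x : g (phi x) = f (delta x) by rewrite /phi; case: cid.
exists (free_map phi) => x.
have := @free_map_unique B (g \o free_map phi : {linear freemod -> B}) f.
by apply=> y /=; rewrite free_map_delta phiE.
Qed.

End Free.

Section FreeCover.
Variables (R : pzRingType).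
Implicit Types M N : lmodType R.

(** Free covers are functorial choices with no minimality: they make the syzygy of
    a module a definite module that can be iterated. *)
Definition free_cover M : lmodType R := freemod R M.
Definition cover_map M : {linear free_cover M -> M} := free_map (fun x : M => x).
Definition syzygy M : lmodType R := ker (cover_map M).
Definition syzygy_in M : {linear syzygy M -> free_cover M} := @ker_in _ _ _ (cover_map M).

Lemma ker_ses M N (f : {linear M -> N}) : surjective f -> ses (@ker_in _ _ _ f) f.
Proof. by move=> fs; split; [exact: ker_in_inj | exact: ker_in_exact | ]. Qed.

Lemma cover_surj M : surjective (cover_map M).
Proof. by move=> x; exists (delta R x); exact: free_map_delta. Qed.

Lemma cover_ses M : ses (syzygy_in M) (cover_map M).
Proof. exact/ker_ses/cover_surj. Qed.

Definition zero_module : lmodType R := freemod R void.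

Lemma zero_module0 (x : zero_module) : x = 0.
Proof. by apply: fcoord_inj => -[]. Qed.

End FreeCover.

(** * The tensor product is right exact, and free modules are flat *)

Notation tml B f := (tens_map (@idfun B) f).
Notation tmr g M := (tens_map g (@idfun M)).

Lemma zmorph0 (A B : zmodType) (f : A -> B) : zmod_morphism f -> f 0 = 0.
Proof. by move=> fB; have := fB 0 0; rewrite !subrr. Qed.

Lemma zmorphN (A B : zmodType) (f : A -> B) : zmod_morphism f ->
  forall x, f (- x) = - f x.
Proof. by move=> fB x; rewrite -sub0r fB (zmorph0 fB) sub0r. Qed.

Lemma zmorphD (A B : zmodType) (f : A -> B) : zmod_morphism f ->
  forall x y, f (x + y) = f x + f y.
Proof. by move=> fB x y; rewrite -[in LHS](opprK y) fB (zmorphN fB) opprK. Qed.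

Lemma zmorph_comp (A B C : zmodType) (f : A -> B) (g : B -> C) :
  zmod_morphism f -> zmod_morphism g -> zmod_morphism (fun x => g (f x)).
Proof. by move=> fB gB x y; rewrite fB gB. Qed.

Section TensorTheory.
Variables (R : pzRingType).
Implicit Types (B : lmodType R^c) (M : lmodType R).

(** A subgroup of the tensor product that contains the elementary tensors is
    everything. *)
Lemma tens_ind B M (P : tensor B M -> Prop) :
  (forall x y, P x -> P y -> P (x - y)) -> (forall b m, P (tens b m)) ->
  forall x, P x.
Proof.
move=> PB Pt x.
have P0 : P 0 by rewrite -(subrr (tens 0 0 : tensor B M)); apply: PB.
have PN y : P y -> P (- y) by rewrite -sub0r; apply: PB.
have PD y z : P y -> P z -> P (y + z) by move=> Py /PN Pz; rewrite -[z]opprK; apply: PB.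
have [u ->] := tens_pi_surj x; rewrite -(freeg_sumE u).
pose p (v : {freeg (B * M)}) : tensor B M := \pi_(Quotient.quot (@tens_ker R B M)) v.
have pB : zmod_morphism p by move=> v w; exact: tens_piB.
rewrite -/(p _); elim: (dom u) => [|[b m] s IH].
  by rewrite big_nil (zmorph0 pB).
rewrite big_cons (zmorphD pB); apply: (PD) => //.
have PMn n : P (p (<< (b, m) >> *+ n)).
  elim: n => [|n IHn]; first by rewrite mulr0n (zmorph0 pB).
  by rewrite mulrS (zmorphD pB); apply: PD => //; exact: Pt b m.
rewrite -[coeff _ _]intz -freegU_mulz; case: (coeff _ _) => n; first exact: PMn.
by rewrite NegzE mulrNz (zmorphN pB); apply: PN; exact: PMn.
Qed.

Lemma tens_morph_eq B M (A : zmodType) (u v : tensor B M -> A) :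
  zmod_morphism u -> zmod_morphism v ->
  (forall b m, u (tens b m) = v (tens b m)) -> u =1 v.
Proof. by move=> uB vB; apply: tens_ind => x y ux vx; rewrite uB vB ux vx. Qed.

Lemma tmap_comp B B' B'' M M' M'' (g : {linear B -> B'}) (g' : {linear B' -> B''})
    (h : {linear B -> B''}) (f : {linear M -> M'}) (f' : {linear M' -> M''})
    (k : {linear M -> M''}) :
  (forall b, g' (g b) = h b) -> (forall m, f' (f m) = k m) ->
  forall x, tens_map g' f' (tens_map g f x) = tens_map h k x.
Proof.
move=> gh fk; apply: (tens_morph_eq (zmorph_comp _ _)); try exact: tens_map_additive.
by move=> b m; rewrite !tens_mapE gh fk.
Qed.

Lemma tmap_comm B B' M M' (g : {linear B -> B'}) (f : {linear M -> M'}) x :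
  tmr g M' (tml B f x) = tml B' f (tmr g M x).
Proof. by rewrite !(tmap_comp (h := g) (k := f)). Qed.

Lemma tml_comp B M M' M'' (f : {linear M -> M'}) (f' : {linear M' -> M''})
  (k : {linear M -> M''}) : (forall m, f' (f m) = k m) ->
  forall x, tml B f' (tml B f x) = tml B k x.
Proof. by move=> fk; apply: tmap_comp. Qed.

Lemma tens0l B M (m : M) : tens (0 : B) m = 0.
Proof.
have [tDl _ _] := tens_balanced B M.
by have /eqP := tDl 0 0 m; rewrite addr0 -subr_eq subrr eq_sym => /eqP.
Qed.

Lemma tens0r B M (b : B) : tens b (0 : M) = 0.
Proof.
have [_ tDr _] := tens_balanced B M.
by have /eqP := tDr b 0 0; rewrite addr0 -subr_eq subrr eq_sym => /eqP.
Qed.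

Lemma tml_comp0 B M M' M'' (f : {linear M -> M'}) (f' : {linear M' -> M''}) :
  (forall m, f' (f m) = 0) -> forall x, tml B f' (tml B f x) = 0.
Proof.
move=> ff; apply: (tens_morph_eq (zmorph_comp _ _)) => [|||b m];
  try exact: tens_map_additive.
  by move=> ? ?; rewrite subrr.
by rewrite !tens_mapE ff tens0r.
Qed.

Lemma tmr_comp0 M B B' B'' (f : {linear B -> B'}) (f' : {linear B' -> B''}) :
  (forall m, f' (f m) = 0) -> forall x, tmr f' M (tmr f M x) = 0.
Proof.
move=> ff; apply: (tens_morph_eq (zmorph_comp _ _)) => [|||b m];
  try exact: tens_map_additive.
  by move=> ? ?; rewrite subrr.
by rewrite !tens_mapE ff tens0l.
Qed.

Lemma tml_surj B M M' (f : {linear M -> M'}) : surjective f -> surjective (tml B f).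
Proof.
move=> fs; apply: tens_ind => [_ _ [x <-] [y <-]|b m].
  by exists (x - y); apply: tens_map_additive.
by have [m' <-] := fs m; exists (tens b m'); rewrite tens_mapE.
Qed.

Lemma tmr_surj M B B' (f : {linear B -> B'}) : surjective f -> surjective (tmr f M).
Proof.
move=> fs; apply: tens_ind => [_ _ [x <-] [y <-]|b m].
  by exists (x - y); apply: tens_map_additive.
by have [m' <-] := fs b; exists (tens m' m); rewrite tens_mapE.
Qed.

(** The map from B (x) M to the cokernel of B (x) f that sends [tens b m] to the
    class of [tens b y], for any lift [y] of [m], inverts the map induced by
    B (x) g, so an element killed by B (x) g is zero in that cokernel. *)
Lemma tml_exact B (K F M : lmodType R) (f : {linear K -> F}) (g : {linear F -> M}) :
  exact f g -> surjective g -> exact (tml B f) (tml B g).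
Proof.
move=> fg gs.
have gf m : g (f m) = 0 by apply/fg; exists m.
pose I t := exists x, tml B f x = t.
have I0 : I 0 by exists 0; apply: zmorph0; exact: tens_map_additive.
have IB x y : I x -> I y -> I (x - y).
  by move=> [x' <-] [y' <-]; exists (x' - y'); apply: tens_map_additive.
have [Q [p [pB _ p0]]] := zquot_exists I0 IB.
have [tDl tDr tZ] := tens_balanced B F.
pose s m := projT1 (cid (gs m)).
have sE m : g (s m) = m by rewrite /s; case: cid.
have pE b y y' : g y = g y' -> p (tens b y) = p (tens b y').
  move=> gy; have /fg[x fx] : g (y - y') = 0 by rewrite linearB gy subrr.
  rewrite -[y](subrK y') tDr (zmorphD pB) (_ : p _ = 0) ?add0r //.
  by apply/p0; exists (tens b x); rewrite tens_mapE /= fx.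
(* Balanced, since p (tens b y) depends on y only through g y. *)
pose phi b m := p (tens b (s m)).
have bal : balanced phi.
  split=> [b b' m|b m m'|a b m]; rewrite /phi.
  - by rewrite tDl (zmorphD pB).
  - by rewrite -(zmorphD pB) -tDr; apply: pE; rewrite linearD !sE.
  - by rewrite tZ; apply: pE; rewrite linearZ /= !sE.
have phiE x : tens_lift phi (tml B g x) = p x.
  move: x; apply: (tens_morph_eq (zmorph_comp _ _)) => //; try exact: tens_map_additive.
    exact: tens_lift_additive.
  by move=> b y; rewrite tens_mapE tens_liftE //; apply: pE; rewrite sE.
move=> y; split=> [gy|[x <-]]; last first.
  exact: tml_comp0.
by apply/p0; rewrite -phiE gy; apply: zmorph0; exact: tens_lift_additive.
Qed.

(** The mirror image of [tml_exact]. *)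
Lemma tmr_exact M (K F B : lmodType R^c) (f : {linear K -> F}) (g : {linear F -> B}) :
  exact f g -> surjective g -> exact (tmr f M) (tmr g M).
Proof.
move=> fg gs.
have gf m : g (f m) = 0 by apply/fg; exists m.
pose I t := exists x, tmr f M x = t.
have I0 : I 0 by exists 0; apply: zmorph0; exact: tens_map_additive.
have IB x y : I x -> I y -> I (x - y).
  by move=> [x' <-] [y' <-]; exists (x' - y'); apply: tens_map_additive.
have [Q [p [pB _ p0]]] := zquot_exists I0 IB.
have [tDl tDr tZ] := tens_balanced F M.
pose s m := projT1 (cid (gs m)).
have sE m : g (s m) = m by rewrite /s; case: cid.
have pE m y y' : g y = g y' -> p (tens y m) = p (tens y' m).
  move=> gy; have /fg[x fx] : g (y - y') = 0 by rewrite linearB gy subrr.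
  rewrite -[y](subrK y') tDl (zmorphD pB) (_ : p _ = 0) ?add0r //.
  by apply/p0; exists (tens x m); rewrite tens_mapE /= fx.
pose phi b m := p (tens (s b) m).
have bal : balanced phi.
  split=> [b b' m|b m m'|a b m]; rewrite /phi.
  - by rewrite -(zmorphD pB) -tDl; apply: pE; rewrite linearD !sE.
  - by rewrite tDr (zmorphD pB).
  - by rewrite -tZ; apply: pE; rewrite linearZ /= !sE.
have phiE x : tens_lift phi (tmr g M x) = p x.
  move: x; apply: (tens_morph_eq (zmorph_comp _ _)) => //; try exact: tens_map_additive.
    exact: tens_lift_additive.
  by move=> b y; rewrite tens_mapE tens_liftE //; apply: pE; rewrite sE.
move=> y; split=> [gy|[x <-]]; last first.
  exact: tmr_comp0.
by apply/p0; rewrite -phiE gy; apply: zmorph0; exact: tens_lift_additive.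
Qed.

(** An element of B (x) R^(X) is determined by its coordinates, which lie in
    B and are natural in B; so an injection on B is an injection on each
    coordinate. *)
Lemma free_flat_left (X : choiceType) : flat_left (freemod R X).
Proof.
move=> B B' g gi; apply: inj_ker; first exact: tens_map_additive.
(* The coordinate at x, as a map from C (x) R^(X) to C. *)
pose c (C : lmodType R^c) x := tens_lift (fun b (f : freemod R X) => (fcoord f x : R^c) *: b : C).
have cbal (C : lmodType R^c) x :
    balanced (fun b (f : freemod R X) => (fcoord f x : R^c) *: b : C).
  split=> [b b' m|b m m'|a b m]; first by rewrite scalerDr.
    by rewrite -scalerDl.
  by rewrite scalerA.
have cB C x : zmod_morphism (c C x) by apply: tens_lift_additive.
pose dec (t : tensor B (freemod R X)) :=
    exists s : seq X, forall s', uniq s' ->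
    {subset s <= s'} -> t = \sum_(x <- s') tens (c B x t) (delta R x).
have decP : forall t, dec t.
  have [tDl tDr tZ] := tens_balanced B (freemod R X).
  apply: (tens_ind (P := dec)) => [t u [s ts] [s' us']|b f].
    exists (s ++ s') => r ur sr.
    rewrite {1}(ts r) // => [|x xs]; last by apply: sr; rewrite mem_cat xs.
    rewrite {1}(us' r) // => [|x xs]; last by apply: sr; rewrite mem_cat xs orbT.
    rewrite -sumrB; apply: eq_bigr => x _; rewrite cB.
    by apply/eqP; rewrite subr_eq -tDl subrK.
  exists (supp f) => s' us' ss.
  rewrite {1}(free_decomp us' ss).
  have tB : zmod_morphism (fun f => tens b f : tensor B (freemod R X)).
    by move=> v w; apply/eqP; rewrite eq_sym subr_eq -tDr subrK.
  elim: (s') => [|x r IH]; first by rewrite !big_nil (zmorph0 tB).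
  by rewrite !big_cons tDr IH -tZ /c tens_liftE.
move=> t gt; have [s st] := decP t; rewrite (st (undup s)) ?undup_uniq // => [|x].
  rewrite big1 // => x _; have -> : c B x t = 0.
    apply/gi; rewrite linear0 -(zmorph0 (cB B' x)) -gt.
    move: {+}t; apply: (tens_morph_eq (zmorph_comp _ _)).
    - exact: cB.
    - by move=> ? ?; rewrite linearB.
    - by apply: zmorph_comp; [exact: tens_map_additive | exact: cB].
    by move=> b f; rewrite /= tens_mapE /c !tens_liftE // linearZ.
  exact: tens0l.
by rewrite mem_undup.
Qed.

(** The mirror image of [free_flat_left]. *)
Lemma free_flat_right (X : choiceType) : flat_right (freemod R^c X).
Proof.
move=> B B' g gi; apply: inj_ker; first exact: tens_map_additive.
pose c (C : lmodType R) x := tens_lift (fun (f : freemod R^c X) b => (fcoord f x : R) *: b : C).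
have cbal (C : lmodType R) x :
    balanced (fun (f : freemod R^c X) b => (fcoord f x : R) *: b : C).
  split=> [b b' m|b m m'|a b m]; first by rewrite -scalerDl.
    by rewrite scalerDr.
  by rewrite scalerA.
have cB C x : zmod_morphism (c C x) by apply: tens_lift_additive.
pose dec (t : tensor (freemod R^c X) B) :=
    exists s : seq X, forall s', uniq s' ->
    {subset s <= s'} -> t = \sum_(x <- s') tens (delta R^c x) (c B x t).
have decP : forall t, dec t.
  have [tDl tDr tZ] := tens_balanced (freemod R^c X) B.
  apply: (tens_ind (P := dec)) => [t u [s ts] [s' us']|f b].
    exists (s ++ s') => r ur sr.
    rewrite {1}(ts r) // => [|x xs]; last by apply: sr; rewrite mem_cat xs.
    rewrite {1}(us' r) // => [|x xs]; last by apply: sr; rewrite mem_cat xs orbT.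
    rewrite -sumrB; apply: eq_bigr => x _; rewrite cB.
    by apply/eqP; rewrite subr_eq -tDr subrK.
  exists (supp f) => s' us' ss.
  rewrite {1}(free_decomp us' ss).
  have tB : zmod_morphism (fun f => tens f b : tensor (freemod R^c X) B).
    by move=> v w; apply/eqP; rewrite eq_sym subr_eq -tDl subrK.
  elim: (s') => [|x r IH]; first by rewrite !big_nil (zmorph0 tB).
  by rewrite !big_cons tDl IH tZ /c tens_liftE.
move=> t gt; have [s st] := decP t; rewrite (st (undup s)) ?undup_uniq // => [|x].
  rewrite big1 // => x _; have -> : c B x t = 0.
    apply/gi; rewrite linear0 -(zmorph0 (cB B' x)) -gt.
    move: {+}t; apply: (tens_morph_eq (zmorph_comp _ _)).
    - exact: cB.
    - by move=> ? ?; rewrite linearB.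
    - by apply: zmorph_comp; [exact: tens_map_additive | exact: cB].
    by move=> f b; rewrite /= tens_mapE /c !tens_liftE // linearZ.
  exact: tens0r.
by rewrite mem_undup.
Qed.

End TensorTheory.

(** * Enough injective modules *)

Definition divisible (D : zmodType) : Prop :=
  forall (d : D) (n : nat), (0 < n)%N -> exists e, e *+ n = d.

Section Extension.
Local Open Scope classical_set_scope.
Variables (A B D : zmodType) (u : A -> B) (f : A -> D).
Hypotheses (divD : divisible D) (uB : zmod_morphism u) (fB : zmod_morphism f).
Hypothesis uf : forall a, u a = 0 -> f a = 0.

(** Partial extensions of [f] along [u] are encoded by their graphs; the graph of
    the function to be extended is [G0]. *)
Let G0 : set (B * D) := [set (u a, f a) | a in setT].

(** The empty graph is admitted: Zorn's lemma also asks for an upper bound of the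
    empty chain. A nonempty graph has to contain [G0]. *)
Let partial (G : set (B * D)) : Prop :=
  [/\ forall z w, G z -> G w -> G (z - w), forall d, G (0, d) -> d = 0
    & G !=set0 -> G0 `<=` G].

Let partialD G z w : partial G -> G z -> G w -> G (z + w).
Proof.
move=> [GB _ _] Gz Gw; rewrite -[w]opprK; apply: (GB) => //.
by rewrite -sub0r; apply: (GB) => //; rewrite -(subrr w); apply: GB.
Qed.

Let partialMz G z q : partial G -> G z -> G (z *~ q).
Proof.
move=> pG Gz; have [GB _ _] := pG.
have GMn n : G (z *+ n).
  elim: n => [|n IH]; first by rewrite mulr0n -(subrr z); apply: GB.
  by rewrite mulrS; apply: partialD.
case: q => n; first exact: GMn.
by rewrite NegzE mulrNz -sub0r; apply: GB; [exact: (GMn 0%N) | exact: GMn].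
Qed.

(** The value that may be given to [x]. The multiples of [x] on which [G] is already
    defined are those of a least positive multiple [n], if there is one; by
    divisibility the prescribed value at [n] times [x] can be divided by [n]. *)
Let slope G x : partial G ->
  exists e, forall (k : int) d, G (x *~ k, d) -> d = e *~ k.
Proof.
move=> pG; have [GB Gf _] := pG.
have [[n0 [n0p Gn0]]|noG] := pselect (exists n, (0 < n)%N /\ exists d, G (x *+ n, d)).
  have exn : exists n, (0 < n)%N && `[< exists d, G (x *+ n, d) >].
    by exists n0; rewrite n0p; apply/asboolP.
  case: (ex_minnP exn) => n /andP[np /asboolP[dn Gn]] minn.
  have [e en] := divD dn np; exists e => k d Gk.
  (* By minimality of n, the remainder r of k modulo n is zero. *)
  have [q [r [kE r_ge0 rn]]] : exists q r : int, [/\ k = q * n + r, 0 <= r & r < n].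
    exists (k %/ n)%Z, (k %% n)%Z; split; first exact: divz_eq.
      by apply: modz_ge0; case: (n) np.
    by rewrite ltz_pmod // ltz_nat.
  have Gr : G (x *~ r, d - dn *~ q).
    have -> : (x *~ r, d - dn *~ q) = (x *~ k, d) - (x *+ n, dn) *~ q.
      have -> : (x *+ n, dn) *~ q = (x *+ n *~ q, dn *~ q).
        by rewrite [LHS]surjective_pairing !raddfMz.
      by congr pair => /=; rewrite kE mulrzDr (pmulrn x n) -mulrzA (mulrC q) addrC addKr.
    by apply: GB => //; apply: partialMz.
  have r0 : r = 0.
    move: Gr rn r_ge0; case: (r) => [[//|m]|//] Gm mn _; suff : (n <= m.+1)%N by rewrite leqNgt -ltz_nat mn.
    by apply: minn; rewrite /=; apply/asboolP; eexists; exact: Gm.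
  have dE : d = dn *~ q by apply/subr0_eq/Gf; move: Gr; rewrite r0.
  by rewrite dE -en kE r0 addr0 (pmulrn e n) -mulrzA (mulrC q).
exists 0 => k d Gk; rewrite mul0rz.
have [k0|k0] := eqVneq k 0; first by apply: Gf; move: Gk; rewrite k0.
case: noG; exists `|k|%N; rewrite absz_gt0; split => //.
case: k Gk k0 => n Gn _; first by exists d.
exists (- d); rewrite -[_ *+ _]/(x *+ n.+1).
have -> : (x *+ n.+1, - d) = (0, 0) - (x *~ Negz n, d).
  by congr pair; rewrite ?NegzE ?mulrNz /= sub0r ?opprK.
by apply: (GB) => //; rewrite -[(0, 0)](subrr (x *~ Negz n, d)); apply: GB.
Qed.

(** A divisible group is an injective object among abelian groups. The relative
    form, with the kernel of [u] inside that of [f], makes it unnecessary to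
    replace A by its image in B. *)
Lemma divisible_extension :
  exists2 g : B -> D, zmod_morphism g & forall a, g (u a) = f a.
Proof.
have pG0 : partial G0.
  split=> [_ _ [a _ <-] [b _ <-]|_ [a _ [ua <-]]|_ //]; last exact: uf.
  by exists (a - b) => //; rewrite uB fB.
have G0n : G0 (0, 0) by exists 0; rewrite ?(zmorph0 uB) ?(zmorph0 fB).
have [|G [pG maxG]] := @Zorn_bigcup _ (partial : set (set (B * D))).
  move=> F FP Ftot; split.
  - move=> z w [X FX Xz] [Y FY Yw].
    have [XY|YX] := Ftot _ _ FX FY.
      by exists Y => //; have [YB _ _] := FP _ FY; apply: YB => //; exact: XY.
    by exists X => //; have [XB _ _] := FP _ FX; apply: XB => //; exact: YX.
  - by move=> d [X FX Xd]; have [_ Xf _] := FP _ FX; exact: Xf.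
  move=> [z [X FX Xz]] t G0t; exists X => //.
  by have [_ _ XG0] := FP _ FX; apply: XG0 => //; exists z.
have [GB Gf GG0] := pG.
have Gn : G !=set0.
  apply: contrapT => nG; apply: (maxG G0 _ pG0); split=> [z Gz|/(_ _ G0n) Gz].
    by case: nG; exists z.
  by apply: nG; exists (0, 0).
have {}GG0 := GG0 Gn.
have tot x : exists d, G (x, d).
  have [e eP] := slope x pG.
  (* If x were outside the domain, adjoining it would enlarge G. *)
  pose G' : set (B * D) := [set z | exists b d (k : int),
    G (b, d) /\ z = (b + x *~ k, d + e *~ k)].
  have GG' : G `<=` G'.
    by move=> [b d] Gbd; exists b, d, 0; split=> //; rewrite !mulr0z !addr0.
  have pG' : partial G'.
    split=> [_ _ [b [d [k [Gbd ->]]]] [b' [d' [k' [Gbd' ->]]]]|d|_ z /GG0/GG' //].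
      exists (b - b'), (d - d'), (k - k'); split; first exact: (GB _ _ Gbd Gbd').
      by congr pair; rewrite /= mulrzBr opprD addrACA.
    move=> [b [d' [k [Gbd [/esym/eqP]]]]]; rewrite addr_eq0 => /eqP bE ->.
    have /eP <- : G (x *~ k, - d'); last by rewrite subrr.
    have -> : (x *~ k, - d') = (0, 0) - (b, d').
      by congr pair; rewrite /= sub0r // bE opprK.
    by apply: (GB) => //; exact: GG0.
  apply: contrapT => nx; apply: (maxG G' _ pG'); split=> // /(_ (x, e)) Gx.
  apply: nx; exists e; apply: Gx; exists 0, 0, 1; split; first exact: GG0.
  by rewrite !add0r !mulr1z.
pose g x := projT1 (cid (tot x)).
have gP x : G (x, g x) by rewrite /g; case: cid.
have gE x d : G (x, d) -> g x = d.
  move=> Gx; apply/subr0_eq/Gf; rewrite -(subrr x).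
  exact: (GB _ _ (gP x) Gx).
exists g => [x y|a]; last by apply/gE/GG0; exists a.
by apply: gE; exact: (GB _ _ (gP x) (gP y)).
Qed.

End Extension.

(** N is a quotient of the free abelian group Z^(N); the hull is the quotient of
    Q^(N) by the same subgroup of relations. *)
Lemma divisible_hull (N : zmodType) : exists (D : zmodType) (i : N -> D),
  [/\ divisible D, zmod_morphism i & injective i].
Proof.
pose ev : {linear freemod int N -> zmodule N} := free_map (fun x => x : zmodule N).
have evE x : ev (delta int x) = x by exact: free_map_delta.
(* L is the image in Q^(N) of the kernel of Z^(N) -> N. *)
pose L (h : freemod rat N) := exists2 g : freemod int N, ev g = 0 &
  forall x, fcoord h x = (fcoord g x)%:~R.
have L0 : L 0 by exists 0; rewrite ?linear0 // => x; rewrite (_ : fcoord _ x = 0).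
have LB h h' : L h -> L h' -> L (h - h').
  move=> [g g0 hg] [g' g'0 hg']; exists (g - g').
    by rewrite linearB g0 g'0 subrr.
  by move=> x; rewrite !fcoordB hg hg' rmorphB.
have [D [p [pB ps p0]]] := zquot_exists L0 LB.
have iB : zmod_morphism (fun x => p (delta rat x)).
  move=> x y; apply/subr0_eq; rewrite -!pB; apply/p0.
  exists (delta int (x - y) - (delta int x - delta int y)).
    by rewrite 2!(linearB ev) !evE; apply: (subrr (x - y : N)).
  by move=> z; rewrite !fcoordB !fcoord_delta !rmorphB /= !rmorph_nat.
exists D, (fun x => p (delta rat x)); split=> //.
  move=> d n np; have [h <-] := ps d; exists (p (n%:R^-1 *: h)).
  have -> m : p (n%:R^-1 *: h) *+ m = p ((n%:R^-1 *: h) *+ m).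
    elim: m => [|m IH]; first by rewrite !mulr0n (zmorph0 pB).
    by rewrite !mulrS IH (zmorphD pB).
  by rewrite -scaler_nat scalerA divff ?scale1r // pnatr_eq0 -lt0n.
apply: inj_ker => // x /p0[g g0 gx].
(* A relation that is a basis vector rationally is one integrally. *)
suff gE : g = delta int x by rewrite -g0 gE evE.
apply: fcoord_inj => y; apply: (@intr_inj rat).
by rewrite -gx !fcoord_delta rmorph_nat.
Qed.

Section HomModule.
Variables (R : pzRingType) (D : zmodType).

(** [hom] is the group Hom_Z(R, D) of additive maps, on which R acts by
    (a h)(r) = h(r a); this is the module coinduced from the group D. *)
Definition additive_pred : {pred R -> D} := fun f => `[< zmod_morphism f >].

Lemma additive_pred_closed : zmod_closed additive_pred.
Proof.
split=> [|f g /asboolP fB /asboolP gB]; apply/asboolP => x y.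
  by rewrite subrr.
have E z : (f - g) z = f z - g z by [].
by rewrite !E fB gB !opprB addrACA [RHS]addrACA [- f y + _]addrC.
Qed.
HB.instance Definition _ :=
  GRing.isZmodClosed.Build (R -> D) additive_pred additive_pred_closed.

Definition hom : Type := {f : R -> D | f \in additive_pred}.
HB.instance Definition _ := [isSub of hom for @sval _ _].
HB.instance Definition _ := [Choice of hom by <:].
HB.instance Definition _ := [SubChoice_isSubZmodule of hom by <:].

Definition hom_fun (h : hom) : R -> D := \val h.

Lemma hom_funB (h : hom) : zmod_morphism (hom_fun h).
Proof. by have /asboolP := valP h. Qed.

Lemma hom_inj h h' : hom_fun h =1 hom_fun h' -> h = h'.
Proof. by move=> hh; apply/val_inj/funext. Qed.

Lemma mk_hom (f : R -> D) : zmod_morphism f -> {h : hom | hom_fun h = f}.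
Proof.
move=> fB; have fP : f \in additive_pred by apply/asboolP.
by exists (exist (fun f => f \in additive_pred) f fP).
Qed.

Fact hom_scale_subproof (a : R) (h : hom) : zmod_morphism (fun r => hom_fun h (r * a)).
Proof. by move=> x y; rewrite mulrBl hom_funB. Qed.

Definition hom_scale (a : R) (h : hom) : hom := projT1 (mk_hom (hom_scale_subproof a h)).

Lemma hom_scaleE a h r : hom_fun (hom_scale a h) r = hom_fun h (r * a).
Proof. by rewrite /hom_scale; case: mk_hom => /= ? ->. Qed.

Lemma hom_funD h h' r : hom_fun (h + h') r = hom_fun h r + hom_fun h' r.
Proof. by []. Qed.

Fact hom_scaleA a b h : hom_scale a (hom_scale b h) = hom_scale (a * b) h.
Proof. by apply: hom_inj => r; rewrite !hom_scaleE mulrA. Qed.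
Fact hom_scale1 : left_id 1 hom_scale.
Proof. by move=> h; apply: hom_inj => r; rewrite hom_scaleE mulr1. Qed.
Fact hom_scaleDr : right_distributive hom_scale +%R.
Proof.
by move=> a h h'; apply: hom_inj => r; rewrite hom_scaleE !hom_funD !hom_scaleE.
Qed.
Fact hom_scaleDl h : {morph hom_scale^~ h : a b / a + b}.
Proof.
move=> a b; apply: hom_inj => r; rewrite hom_scaleE !hom_funD !hom_scaleE.
by rewrite mulrDr (zmorphD (hom_funB h)).
Qed.
HB.instance Definition _ := GRing.Zmodule_isLmodule.Build R hom
  hom_scaleA hom_scale1 hom_scaleDr hom_scaleDl.

Lemma hom_funZ a (h : hom) r : hom_fun (a *: h) r = hom_fun h (r * a).
Proof. exact: hom_scaleE. Qed.

(** Coinduction is right adjoint to the forgetful functor. *)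
Lemma mk_hom_linear (M : lmodType R) (f : M -> D) : zmod_morphism f ->
  exists g : {linear M -> hom}, forall x r, hom_fun (g x) r = f (r *: x).
Proof.
move=> fB.
have hB x : zmod_morphism (fun r => f (r *: x)) by move=> r s; rewrite scalerBl fB.
pose g x : hom := projT1 (mk_hom (hB x)).
have gE x r : hom_fun (g x) r = f (r *: x) by rewrite /g; case: mk_hom => /= ? ->.
have gl : linear g.
  move=> a x y; apply: hom_inj => r; rewrite hom_funD hom_funZ !gE.
  by rewrite scalerDr (zmorphD fB) scalerA.
pose gL := GRing.isLinear.Build R M hom *:%R g gl.
pose g' : {linear M -> hom} := HB.pack g gL.
by exists g' => x r; rewrite -gE.
Qed.

End HomModule.

(** In this relative form [u] need not be injective, and so the definition applies
    directly to a differential [d 0] of a resolution. *)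
Definition injective_module (R : pzRingType) (E : lmodType R) : Prop :=
  forall (A B : lmodType R) (u : {linear A -> B}) (f : {linear A -> E}),
    (forall x, u x = 0 -> f x = 0) ->
    exists g : {linear B -> E}, forall x, g (u x) = f x.

Lemma hom_injective (R : pzRingType) (D : zmodType) : divisible D ->
  injective_module (hom R D).
Proof.
move=> divD A B u f uf.
have uB : zmod_morphism u by move=> x y; rewrite linearB.
pose f1 x := hom_fun (f x) 1.
have f1B : zmod_morphism f1 by move=> x y; rewrite /f1 linearB.
have [|g1 g1B g1E] := divisible_extension divD uB f1B.
  by move=> a /uf; rewrite /f1 => ->.
have [g gE] := mk_hom_linear g1B; exists g => x; apply: hom_inj => r.
by rewrite gE -linearZ g1E /f1 linearZ hom_funZ mul1r.
Qed.

(** The unit of the coinduction adjunction, followed by the embedding of N in a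
    divisible group: x goes to the map r |-> r x. *)
Lemma enough_injectives (R : pzRingType) (N : lmodType R) :
  exists (E : lmodType R) (i : {linear N -> E}), injective_module E /\ injective i.
Proof.
have [D [i [divD iB ii]]] := divisible_hull N.
have [g gE] := mk_hom_linear iB; exists (hom R D), g; split.
  exact: hom_injective.
move=> x y gxy; apply: ii; rewrite -[x]scale1r -[y]scale1r -!gE.
by rewrite gxy.
Qed.

Lemma injective_FPinj (R : pzRingType) (k : nat) (E : lmodType R) :
  injective_module E -> FPinj k E.
Proof.
move=> injE M _ P d e [_ _ ex0 ex] f fd.
apply: injE => x /(ex 0%N)[y <-]; exact: fd.
Qed.

(** * Vanishing of Tor *)

Lemma exact0 (A B C : zmodType) (f : A -> B) (g : B -> C) x : exact f g -> g (f x) = 0.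
Proof. by move=> fg; apply/fg; exists x. Qed.

(** The part of the snake lemma that is needed. The rows are K, F, M tensored with
    L, Q, B in turn, the columns are L, Q, B tensored with K, F, M; an element of
    the kernel of [iM] is traced along the connecting map into the kernel of
    [a'']. *)
Lemma diagram_chase (LK LF LM QK QF QM BK BF : zmodType)
    (a : LK -> LF) (b : LF -> LM) (a' : QK -> QF) (b' : QF -> QM) (a'' : BK -> BF)
    (iK : LK -> QK) (iF : LF -> QF) (iM : LM -> QM) (pK : QK -> BK) (pF : QF -> BF) :
  zmod_morphism iM -> zmod_morphism a'' ->
  (forall x, iF (a x) = a' (iK x)) -> (forall x, iM (b x) = b' (iF x)) ->
  (forall x, pF (a' x) = a'' (pK x)) ->
  exact a b -> surjective b -> exact a' b' -> exact iK pK -> exact iF pF ->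
  injective iF -> injective a'' -> injective iM.
Proof.
move=> iMB aB sq1 sq2 sq3 ab bs a'b' ipK ipF iFi a''i.
apply: inj_ker => // x ix; have [y yx] := bs x.
have /a'b'[z za] : b' (iF y) = 0 by rewrite -sq2 yx.
have /ipK[w wz] : pK z = 0.
  by apply: a''i; rewrite (zmorph0 aB) -sq3 za (exact0 _ ipF).
have awy : a w = y by apply: iFi; rewrite sq1 wz.
by rewrite -yx -awy (exact0 _ ab).
Qed.

Section Tor.
Variables (R : pzRingType).
Implicit Types (B L Q N E : lmodType R^c) (M K F G : lmodType R).

(** With [tor_transfer'], this is the balance of Tor_1: its vanishing for B and M
    passes between presentations of one argument and of the other. *)
Lemma tor_transfer L Q B (g : {linear L -> Q}) (h : {linear Q -> B})
    K F M (f : {linear K -> F}) (e : {linear F -> M}) :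
  ses g h -> ses f e ->
  injective (tmr g F) -> injective (tml B f) -> injective (tmr g M).
Proof.
move=> [_ gh hs] [_ fe es] gF fB.
apply: (diagram_chase (a := tml L f) (b := tml L e) (a' := tml Q f) (b' := tml Q e)
   (a'' := tml B f) (iK := tmr g K) (iF := tmr g F) (pK := tmr h K) (pF := tmr h F));
 do ?[exact: tens_map_additive | exact: tml_exact | exact: tmr_exact
   | exact: tml_surj | by move=> x; rewrite tmap_comm] => //.
Qed.

Lemma tor_transfer' L Q B (g : {linear L -> Q}) (h : {linear Q -> B})
    K F M (f : {linear K -> F}) (e : {linear F -> M}) :
  ses g h -> ses f e ->
  injective (tml Q f) -> injective (tmr g M) -> injective (tml B f).
Proof.
move=> [_ gh hs] [_ fe es] fQ gM.
apply: (diagram_chase (a := tmr g K) (b := tmr h K) (a' := tmr g F) (b' := tmr h F)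
   (a'' := tmr g M) (iK := tml L f) (iF := tml Q f) (pK := tml L e) (pF := tml Q e));
 do ?[exact: tens_map_additive | exact: tml_exact | exact: tmr_exact
   | exact: tmr_surj | by move=> x; rewrite tmap_comm] => //.
Qed.

Definition tor1_eq0 B M : Prop := injective (tml B (syzygy_in M)).

Lemma cover_flat_left M : flat_left (free_cover M).
Proof. exact: free_flat_left. Qed.

Lemma cover_flat_right B : flat_right (free_cover B).
Proof. exact: free_flat_right. Qed.

Lemma tor1_right L Q B (g : {linear L -> Q}) (h : {linear Q -> B}) M :
  flat_right Q -> ses g h -> injective (tmr g M) <-> tor1_eq0 B M.
Proof.
move=> Qf gh; split.
  by apply: (tor_transfer' gh (cover_ses M)); apply: Qf; case: (cover_ses M).
by apply: (tor_transfer gh (cover_ses M)); apply: cover_flat_left; case: gh.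
Qed.

Lemma tor1_left B K F M (f : {linear K -> F}) (e : {linear F -> M}) :
  flat_left F -> ses f e -> injective (tml B f) <-> tor1_eq0 B M.
Proof.
move=> Ff fe; rewrite -(tor1_right _ (@cover_flat_right B) (cover_ses B)); split.
  by apply: (tor_transfer (cover_ses B) fe); apply: Ff; case: (cover_ses B).
by apply: (tor_transfer' (cover_ses B) fe); apply: cover_flat_right; case: fe.
Qed.

(** Both sides say that L (x) K maps injectively to Q (x) F, once through L (x) F
    and once through Q (x) K: this is the isomorphism of Tor_1(L, M) and
    Tor_1(B, K), both of them being Tor_2(B, M). *)
Lemma tor1_shift L Q B (g : {linear L -> Q}) (h : {linear Q -> B})
    K F M (f : {linear K -> F}) (e : {linear F -> M}) :
  flat_right Q -> ses g h -> flat_left F -> ses f e ->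
  tor1_eq0 L M <-> tor1_eq0 B K.
Proof.
move=> Qf gh Ff fe; rewrite -(tor1_left _ Ff fe) -(tor1_right _ Qf gh).
have gF : injective (tmr g F) by apply: Ff; case: gh.
have fQ : injective (tml Q f) by apply: Qf; case: fe.
have comm := tmap_comm g f.
split=> inj x y xy; [apply: inj; apply: gF | apply: inj; apply: fQ].
  by rewrite !comm xy.
by rewrite -!comm xy.
Qed.

(** The cokernel C of an injection of right modules controls its tensor product with
    M through Tor_1(C, M). *)
Lemma flat_left_tor M : flat_left M <-> forall B, tor1_eq0 B M.
Proof.
split=> [Mf B|Mt B B' g gi].
  by apply/(tor1_right _ (@cover_flat_right B) (cover_ses B))/Mf; case: (cover_ses B).
apply: (tor_transfer (coker_ses gi) (cover_ses M)); last exact: Mt.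
exact: cover_flat_left.
Qed.

Lemma flat_right_tor B : flat_right B <-> forall M, tor1_eq0 B M.
Proof.
split=> [Bf M|Bt M M' f fi].
  by apply: Bf; case: (cover_ses M).
apply: (tor_transfer' (cover_ses B) (coker_ses fi)); first exact: cover_flat_right.
exact/(tor1_right _ (@cover_flat_right B) (cover_ses B)).
Qed.

Lemma tor1_iter_syzygy j B M :
  tor1_eq0 B (iter j (@syzygy R) M) <-> tor1_eq0 (iter j (@syzygy R^c) B) M.
Proof.
elim: j B => [|j IH] B //; rewrite [iter j.+1 _ B]iterSr -IH /=.
apply: iff_sym; exact: (tor1_shift (@cover_flat_right B) (cover_ses B)
  (@cover_flat_left _) (cover_ses _)).
Qed.

Lemma tor1_syzygyS j B K F M (f : {linear K -> F}) (e : {linear F -> M}) :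
  flat_left F -> ses f e ->
  tor1_eq0 B (iter j (@syzygy R) K) <-> tor1_eq0 B (iter j.+1 (@syzygy R) M).
Proof.
move=> Ff fe; rewrite !tor1_iter_syzygy; apply: iff_sym.
exact: (tor1_shift (@cover_flat_right _) (cover_ses _) Ff fe).
Qed.

(** A piece of the long exact sequence: Tor_2(B, G) = 0 and Tor_1(B, K) = 0 give
    Tor_2(B, M) = 0, where Tor_2(B, -) is Tor_1 of the syzygy of B. *)
Lemma tor1_extension B K G M (f : {linear K -> G}) (e : {linear G -> M}) :
  ses f e -> tor1_eq0 B K -> tor1_eq0 (syzygy B) G -> tor1_eq0 (syzygy B) M.
Proof.
move=> fe BK BG.
have gK : injective (tmr (syzygy_in B) K).
  exact/(tor1_right _ (@cover_flat_right B) (cover_ses B)).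
have fQ : injective (tml (free_cover B) f) by apply: cover_flat_right; case: fe.
have fL : injective (tml (syzygy B) f).
  by move=> x y xy; apply: gK; apply: fQ; rewrite -!tmap_comm xy.
apply/(tor1_right _ (@cover_flat_right _) (cover_ses _)).
apply: (tor_transfer (cover_ses _) fe) => //.
exact/(tor1_right _ (@cover_flat_right _) (cover_ses _)).
Qed.

(** When M has flat dimension at most 1, Tor_2 vanishes, so Tor_1(N, M) embeds in
    Tor_1(E, M). *)
Lemma tor1_embedding N E M (i : {linear N -> E}) : injective i ->
  flat_left (syzygy M) -> tor1_eq0 E M -> tor1_eq0 N M.
Proof.
move=> ii Kf EM x y xy; apply: (Kf _ _ i ii); apply: EM.
by rewrite -!tmap_comm xy.
Qed.

End Tor.

Lemma ses_iso (R : pzRingType) (K F M N : lmodType R) (f : {linear K -> F})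
    (g : {linear F -> M}) (h : {linear M -> N}) :
  injective h -> surjective h -> ses f g -> ses f (h \o g).
Proof.
move=> hi hs [fi fg gs]; split=> // y.
  split=> [/= hy|[x <-] /=]; last by rewrite (exact0 _ fg) linear0.
  by apply/fg/hi; rewrite hy linear0.
by have [x <-] := hs y; have [z <-] := gs x; exists z.
Qed.

Section Resolutions.
Variables (R : pzRingType).
Implicit Types (C D : modclass R) (M N : lmodType R).

(** Resolutions cut into short exact sequences: the terms in degrees below [j] lie in
    [C] and the remaining j-th syzygy lies in [D]. With [D] the class of modules
    equal to K, this says that K is a j-th syzygy by modules in [C]. *)
Fixpoint res C D (j : nat) M : Prop :=
  if j is j'.+1 then
    exists (K F : lmodType R) (f : {linear K -> F}) (g : {linear F -> M}),
      [/\ C F, ses f g & res C D j' K]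
  else D M.

Lemma res_syzygy C D j M : (forall X, C (free_cover X)) -> D (iter j (@syzygy R) M) ->
  res C D j M.
Proof.
move=> Cc; elim: j M => [//|j IH] M; rewrite iterSr => /IH rK.
by exists (syzygy M), (free_cover M), (syzygy_in M), (cover_map M); split=> //; exact: cover_ses.
Qed.

Definition iso_closed C := forall M N (f : {linear M -> N}),
  injective f -> surjective f -> C M -> C N.

Lemma has_resolution_res C j M : iso_closed C -> has_resolution C j M -> res C C j M.
Proof.
move=> Ci; elim: j M => [|j IH] M [G [d [e [es ex0 ex CG G0]]]] /=.
  apply: (Ci _ _ e _ es); last exact: CG.
  apply: inj_ker => [x y|x /ex0[y <-]]; first by rewrite linearB.
  by rewrite (G0 1%N erefl y) linear0.
have [|h hE] := linear_lift (g := d 0%N) (@ker_in_inj _ _ _ e).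
  by move=> x; apply/ker_in_exact; exact: (exact0 _ ex0).
exists (ker e), (G 0%N), (@ker_in _ _ _ e), e; split; first exact: CG.
  exact: ker_ses.
apply: IH; exists (fun i => G i.+1), (fun i => d i.+1), h; split.
- move=> y; have /ex0[x xE] : e (ker_in y) = 0 by apply/ker_in_exact; exists y.
  by exists x; apply: (@ker_in_inj _ _ _ e); rewrite hE.
- move=> x; split=> [hx|/ex dx].
    by apply/ex; rewrite -hE hx linear0.
  by apply: (@ker_in_inj _ _ _ e); rewrite hE dx linear0.
- by move=> i; exact: ex.
- by move=> i ij; exact: CG.
by move=> i ij; exact: G0.
Qed.

Lemma res_has_resolution C j M : res C C j M -> has_resolution C j M.
Proof.
elim: j M => [|j IH] M /=.
  move=> CM; pose G i : lmodType R := if i is _.+1 then zero_module R else M.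
  exists G, (fun i => \0 : {linear G i.+1 -> G i}), idfun; split=> //.
  - by move=> y; exists y.
  - move=> y; split=> [/= ->|[x <-]]; last by [].
    by exists 0.
  - by move=> i y; split=> [_|_]; [exists 0|]; rewrite [y]zero_module0 ?linear0.
  - by case.
  by case=> // i _; exact: zero_module0.
move=> [K [F [f [g [CF [fi fg gs] /IH[G [d [e [es ex0 ex CG G0]]]]]]]]].
pose G' i := if i is i'.+1 then G i' else F.
pose d' i : {linear G' i.+1 -> G' i} :=
  if i is i'.+1 return {linear G' i.+1 -> G' i} then d i' else f \o e.
exists G', d', g; split=> //.
- move=> y; split=> [/fg[x <-]|[x <-]].
    by have [z <-] := es x; exists z.
  exact: (exact0 _ fg).
- case=> [|i]; last exact: ex.
  move=> y; split=> /= [fe|[x <-]]; last by rewrite /= (exact0 _ ex0) linear0.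
  by apply/ex0/fi; rewrite linear0.
- by case.
by case.
Qed.

End Resolutions.

(** * Flat dimension, and construction of Gorenstein flat modules *)

(** Two short exact sequences may be spliced; only the middle one of the three
    sequences around Y has to be exact at Y. *)
Lemma splice (X X1 Y Z Z1 : zmodType) (p : X -> X1) (i : X1 -> Y) (q : Y -> Z1)
    (j : Z1 -> Z) (u : X -> Y) (v : Y -> Z) :
  surjective p -> exact i q -> injective j -> zmod_morphism j ->
  (forall x, u x = i (p x)) -> (forall y, v y = j (q y)) -> exact u v.
Proof.
move=> ps iq ji jB uE vE y; rewrite vE; split=> [|[x <-]].
  rewrite -(zmorph0 jB) => /ji/iq[x1 <-]; have [x <-] := ps x1.
  by exists x; rewrite uE.
by rewrite uE (exact0 _ iq) (zmorph0 jB).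
Qed.

Section FlatDimension.
Variables (R : pzRingType).
Implicit Types (B : lmodType R^c) (M N : lmodType R).

Lemma flat_left_iso : iso_closed (@flat_left R).
Proof.
move=> M N f fi fs /flat_left_tor Mf; apply/flat_left_tor => B.
apply/(tor1_left _ (@cover_flat_left _ M) (ses_iso fi fs (cover_ses M))).
exact: Mf.
Qed.

Lemma flat_right_iso : iso_closed (@flat_right R).
Proof.
move=> M N f fi fs /flat_right_tor Mf; apply/flat_right_tor => A.
apply/(tor1_right _ (@cover_flat_right _ M) (ses_iso fi fs (cover_ses M))).
exact/(tor1_right _ (@cover_flat_right _ M) (cover_ses M)).
Qed.

Lemma res_flat_right_tor j B : res (@flat_right R) (@flat_right R) j B ->
  forall M, tor1_eq0 B (iter j (@syzygy R) M).
Proof.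
elim: j B => [|j IH] B /=; first by move/flat_right_tor.
move=> [K [F [f [g [Ff fg /IH rK]]]]] M.
exact/(tor1_shift Ff fg (@cover_flat_left _ _) (cover_ses _)).
Qed.

Lemma fd_right_tor j B :
  (fd_right B <= (Posz j)%:E)%E <-> forall M, tor1_eq0 B (iter j (@syzygy R) M).
Proof.
split=> [/dim_inf_le[i ij /(has_resolution_res flat_right_iso)/res_flat_right_tor H] M|H].
  by rewrite -(subnKC ij) iterD; exact: H.
apply/dim_inf_le; exists j => //; apply: res_has_resolution.
apply: res_syzygy => [X|]; first exact: cover_flat_right.
by apply/flat_right_tor => M; rewrite -tor1_iter_syzygy.
Qed.

Lemma res_flat_left_tor j M : res (@flat_left R) (@flat_left R) j M ->
  forall B, tor1_eq0 B (iter j (@syzygy R) M).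
Proof.
elim: j M => [|j IH] M /=; first by move/flat_left_tor.
move=> [K [F [f [g [Ff fg /IH rK]]]]] B.
exact/(tor1_syzygyS _ _ Ff fg).
Qed.

Lemma fd_left_tor j M : (fd_left M <= (Posz j)%:E)%E ->
  forall B, tor1_eq0 B (iter j (@syzygy R) M).
Proof.
move=> /dim_inf_le[i ij /(has_resolution_res flat_left_iso)/res_flat_left_tor H] B.
by rewrite tor1_iter_syzygy -(subnKC ij) iterD -tor1_iter_syzygy; exact: H.
Qed.

(** Descending induction from [m] to [s]. If the syzygy of Om^j I is flat, then
    Om^j I has flat dimension at most 1, and for j >= s it has no Tor_1 with
    injective right modules; every right module embeds in one of these. *)
Lemma fd_left_injective (s m : nat) (I : lmodType R) :
  (forall E : lmodType R^c, injective_module E -> (fd_right E <= (Posz s)%:E)%E) ->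
  (forall B, tor1_eq0 B (iter m (@syzygy R) I)) ->
  forall B, tor1_eq0 B (iter s (@syzygy R) I).
Proof.
move=> fdE Im; have [ms|/ltnW sm] := leqP m s.
  move=> B; rewrite tor1_iter_syzygy -(subnKC ms) iterD -tor1_iter_syzygy.
  exact: Im.
rewrite -(subnKC sm) in Im; elim: (m - s)%N Im => [|t IH]; first by rewrite addn0.
move=> It; apply: IH => N; have [E [i [Einj ii]]] := enough_injectives N.
apply: (tor1_embedding ii); first by apply/flat_left_tor; rewrite -iterS -addnS.
by rewrite iterD; have /fd_right_tor := fdE E Einj.
Qed.

End FlatDimension.

Section GorensteinFlat.
Variables (R : pzRingType) (BB : modclass R^c).
Implicit Types (B : lmodType R^c) (K M N : lmodType R).

(** One step of a flat resolution, or coresolution, that stays inside [P]; as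
    records, the steps can be chosen once and for all and then iterated. *)
Record left_step (P : modclass R) K := LeftStep {
  ls_K : lmodType R; ls_F : lmodType R;
  ls_f : {linear ls_K -> ls_F}; ls_g : {linear ls_F -> K};
  ls_P : P ls_K; ls_flat : flat_left ls_F; ls_ses : ses ls_f ls_g }.

Record right_step (P : modclass R) K := RightStep {
  rs_K : lmodType R; rs_F : lmodType R;
  rs_f : {linear K -> rs_F}; rs_g : {linear rs_F -> rs_K};
  rs_P : P rs_K; rs_flat : flat_left rs_F; rs_ses : ses rs_f rs_g }.

(** A class closed under some flat covers and some flat embeddings, with no Tor_1
    against BB, consists of Gorenstein flat modules: splice the steps. The
    complex stays exact after tensoring because Tor_1 vanishes on all the
    kernels. *)
Lemma GF_coind (P : modclass R) :
  (forall K, P K -> forall B, BB B -> tor1_eq0 B K) ->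
  (forall K, P K -> inhabited (left_step P K)) ->
  (forall K, P K -> inhabited (right_step P K)) ->
  forall K, P K -> GF BB K.
Proof.
move=> Pt Pl Pr K0 PK0.
pose T := {K : lmodType R | P K}.
pose x0 : T := exist _ K0 PK0.
pose lc (x : T) : left_step P (sval x) := inhabited_witness (Pl _ (proj2_sig x)).
pose rc (x : T) : right_step P (sval x) := inhabited_witness (Pr _ (proj2_sig x)).
pose lx := fix lx i : T :=
  if i is i'.+1 then exist _ (ls_K (lc (lx i'))) (ls_P (lc (lx i'))) else x0.
pose rx := fix rx i : T :=
  if i is i'.+1 then exist _ (rs_K (rc (rx i'))) (rs_P (rc (rx i'))) else x0.
pose Fl i := ls_F (lc (lx i)); pose Fr i := rs_F (rc (rx i)).
pose lf i : {linear sval (lx i.+1) -> Fl i} := ls_f (lc (lx i)).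
pose lg i : {linear Fl i -> sval (lx i)} := ls_g (lc (lx i)).
pose rf i : {linear sval (rx i) -> Fr i} := rs_f (rc (rx i)).
pose rg i : {linear Fr i -> sval (rx i.+1)} := rs_g (rc (rx i)).
have lflat i : flat_left (Fl i) by exact: ls_flat.
have rflat i : flat_left (Fr i) by exact: rs_flat.
have lses i : ses (lf i) (lg i) := ls_ses (lc (lx i)).
have rses i : ses (rf i) (rg i) := rs_ses (rc (rx i)).
pose dl i : {linear Fl i.+1 -> Fl i} := lf i \o lg i.+1.
pose dr i : {linear Fr i -> Fr i.+1} := rf i.+1 \o rg i.
pose d : {linear Fl 0%N -> Fr 0%N} := (rf 0%N : {linear sval (lx 0%N) -> _}) \o lg 0%N.
exists Fl, Fr, dl, d, dr; split.
- by move=> i; split.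
- split=> [i||| i].
  + have [[[_ _ gs] [_ fg _]] [fi _ _]] := (lses i.+2, lses i.+1, lses i).
    by apply: (splice gs fg fi) => // x y; rewrite linearB.
  + have [[[_ _ gs] [_ fg _]] [fi _ _]] := (lses 1%N, lses 0%N, rses 0%N).
    by apply: (splice gs fg fi) => // x y; rewrite linearB.
  + have [[[_ _ gs] [_ fg _]] [fi _ _]] := (lses 0%N, rses 0%N, rses 1%N).
    by apply: (splice gs fg fi) => // x y; rewrite linearB.
  have [[[_ _ gs] [_ fg _]] [fi _ _]] := (rses i, rses i.+1, rses i.+2).
  by apply: (splice gs fg fi) => // x y; rewrite linearB.
- move=> B BBB.
  have tB M N (f : {linear M -> N}) := tens_map_additive (@idfun B : {linear B -> B}) f.
  have lt i : ses (tml B (lf i)) (tml B (lg i)).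
    have [fi fg gs] := lses i; split; [|exact: tml_exact|exact: tml_surj].
    apply/(tor1_left _ (lflat i) (lses i)).
    exact: (Pt _ (proj2_sig (lx i))).
  have rt i : ses (tml B (rf i)) (tml B (rg i)).
    have [fi fg gs] := rses i; split; [|exact: tml_exact|exact: tml_surj].
    apply/(tor1_left _ (rflat i) (rses i)).
    exact: (Pt _ (proj2_sig (rx i.+1))).
  split=> [i||| i].
  + have [[[_ _ gs] [_ fg _]] [fi _ _]] := (lt i.+2, lt i.+1, lt i).
    by apply: (splice gs fg fi) => // x; rewrite (tml_comp (k := dl _)).
  + have [[[_ _ gs] [_ fg _]] [fi _ _]] := (lt 1%N, lt 0%N, rt 0%N).
    apply: (splice gs fg fi) => // x; first by rewrite (tml_comp (k := dl _)).
    by rewrite (tml_comp (k := d)).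
  + have [[[_ _ gs] [_ fg _]] [fi _ _]] := (lt 0%N, rt 0%N, rt 1%N).
    apply: (splice gs fg fi) => // x; last by rewrite (tml_comp (k := dr _)).
    by rewrite (tml_comp (k := d)).
  have [[[_ _ gs] [_ fg _]] [fi _ _]] := (rt i, rt i.+1, rt i.+2).
  by apply: (splice gs fg fi) => // x; rewrite (tml_comp (k := dr _)).
exists (rf 0%N); have [[fi fg _] [fi1 _ _]] := (rses 0%N, rses 1%N).
split=> //; apply: (splice (p := id) _ fg fi1) => //; first by move=> x; exists x.
by move=> x y; rewrite linearB.
Qed.

(** Splicing 0 -> K -> K -> 0 -> 0 and 0 -> 0 -> K -> K -> 0. *)
Lemma flat_GF K : flat_left K -> GF BB K.
Proof.
have zero_flat : flat_left (zero_module R) by exact: free_flat_left.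
apply: GF_coind => {}K Kf; first by move/flat_left_tor: Kf => Kt B _; exact: Kt.
- pose f : {linear zero_module R -> K} := \0.
  have fP : ses f (idfun : {linear K -> K}).
    split=> [x y _|y|y]; [by rewrite [x]zero_module0 [y]zero_module0 | | by exists y].
    by split=> [/= ->|[x <-]]; [exists 0 |].
  by split; exact: (LeftStep zero_flat Kf fP).
pose f : {linear K -> zero_module R} := \0.
have fP : ses (idfun : {linear K -> K}) f.
  split=> [x y //|y|y]; last by exists 0; rewrite [y]zero_module0.
  by split=> // _; exists y.
by split; exact: (RightStep zero_flat Kf fP).
Qed.

Lemma GF_iso : iso_closed (GF BB).
Proof.
move=> M N f fi fs [Fl [Fr [dl [d [dr [flat ac acB [io [ioi ioe]]]]]]]].
exists Fl, Fr, dl, d, dr; split=> //.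
have [|h hE] := linear_lift (g := idfun : {linear N -> N}) fi.
  by move=> x; exact: fs.
exists (io \o h); split=> [x y /= /ioi hxy|y].
  by rewrite -[x]hE -[y]hE hxy.
split=> [/ioe[x <-]|[x <-]]; last exact: (exact0 _ ioe).
by exists (f x) => /=; congr (io _); apply: fi; rewrite hE.
Qed.

(** The left half of the defining complex. Unlike the class of Gorenstein flat
    modules, it passes to the first syzygy by a mere shift of indices. *)
Definition left_GF M : Prop :=
  exists (F : nat -> lmodType R) (d : forall i, {linear F i.+1 -> F i})
         (e : {linear F 0%N -> M}),
    [/\ forall i, flat_left (F i), surjective e, exact (d 0%N) e,
        forall i, exact (d i.+1) (d i)
      & forall B, BB B -> forall i, exact (tml B (d i.+1)) (tml B (d i))].

Lemma GF_left_GF M : GF BB M -> left_GF M.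
Proof.
move=> [Fl [Fr [dl [d [dr [flat [ac0 ac1 ac2 _] acB [io [ioi ioe]]]]]]]].
have [x|e eE] := linear_lift (g := d) ioi; first by apply/ioe/ac2; exists x.
exists Fl, dl, e; split=> [i|y|x|i|B BBB i].
- by case: (flat i).
- have /ac2[x dx] : dr 0%N (io y) = 0 by apply: (exact0 _ ioe).
  by exists x; apply: ioi; rewrite eE.
- split=> [ex|/ac1 dx]; last by apply: ioi; rewrite eE dx linear0.
  by apply/ac1; rewrite -eE ex linear0.
- exact: ac0.
by case: (acB B BBB).
Qed.

(** An element of B (x) K killed in B (x) F 0 lifts to a cycle of
    B (x) F 1, hence to a boundary, and boundaries vanish in B (x) K. *)
Lemma left_GF_syzygy M : left_GF M ->
  exists (K F : lmodType R) (f : {linear K -> F}) (g : {linear F -> M}),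
    [/\ flat_left F, ses f g, left_GF K & forall B, BB B -> tor1_eq0 B M].
Proof.
move=> [F [d [e [flat es ex0 ex exB]]]].
have ki : injective (@ker_in _ _ _ e) by exact: ker_in_inj.
have [x|h hE] := linear_lift (g := d 0%N) ki.
  by apply/ker_in_exact; exact: (exact0 _ ex0).
have hs : surjective h.
  move=> y; have /ex0[x xE] : e (ker_in y) = 0 by apply/ker_in_exact; exists y.
  by exists x; apply: ki; rewrite hE.
have hd : exact (d 1%N) h.
  move=> x; split=> [hx|/ex dx]; first by apply/ex; rewrite -hE hx linear0.
  by apply: ki; rewrite hE dx linear0.
exists (ker e), (F 0%N), (@ker_in _ _ _ e), e; split=> //; first exact: ker_ses.
  exists (fun i => F i.+1), (fun i => d i.+1), h; split=> // B BBB i; exact: exB.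
move=> B BBB; apply/(tor1_left _ (flat 0%N) (ker_ses es)).
apply: inj_ker; first exact: tens_map_additive.
move=> x; have [y <-] := tml_surj hs x.
rewrite (tml_comp (k := d 0%N)) // => /(exB B BBB 0%N)[w <-].
by apply: tml_comp0 => z; exact: (exact0 _ hd).
Qed.

Lemma left_GF_tor B j M : BB B -> left_GF M -> tor1_eq0 B (iter j (@syzygy R) M).
Proof.
move=> BBB; elim: j M => [|j IH] M /left_GF_syzygy[K [F [f [g [Ff fg gK tM]]]]].
  exact: tM.
by apply/(tor1_syzygyS _ _ Ff fg); exact: IH.
Qed.

End GorensteinFlat.

(** * The horseshoe lemma and the theorem *)

Section Horseshoe.
Variables (R : pzRingType).
Implicit Types (A B C F G M N : lmodType R).

Definition pair_l F G (x : F) : F * G := (x, 0).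
Definition pair_r F G (y : G) : F * G := (0, y).

Fact pair_l_linear F G : linear (@pair_l F G).
Proof. by move=> a x y; congr pair; rewrite /= scaler0 addr0. Qed.
HB.instance Definition _ F G :=
  GRing.isLinear.Build R F (F * G)%type *:%R (@pair_l F G) (@pair_l_linear F G).

Fact pair_r_linear F G : linear (@pair_r F G).
Proof. by move=> a x y; congr pair; rewrite /= scaler0 addr0. Qed.
HB.instance Definition _ F G :=
  GRing.isLinear.Build R G (F * G)%type *:%R (@pair_r F G) (@pair_r_linear F G).

(** An element of B (x) (F x G) is the sum of the images of its two components. *)
Lemma flat_left_prod F G : flat_left F -> flat_left G -> flat_left (F * G)%type.
Proof.
move=> Ff Gf B B' g gi; apply: inj_ker; first exact: tens_map_additive.
move=> x gx.
pose p1 : {linear (F * G)%type -> F} := fst; pose p2 : {linear (F * G)%type -> G} := snd.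
have inj0 M : flat_left M -> forall y : tensor B M, tmr g M y = 0 -> y = 0.
  move=> Mf y gy; apply: (Mf _ _ _ gi).
  by rewrite gy (zmorph0 (tens_map_additive _ _)).
have z1 : tml B p1 x = 0.
  by apply: (inj0 _ Ff); rewrite tmap_comm gx (zmorph0 (tens_map_additive _ _)).
have z2 : tml B p2 x = 0.
  by apply: (inj0 _ Gf); rewrite tmap_comm gx (zmorph0 (tens_map_additive _ _)).
have <- : tml B (@pair_l F G) (tml B p1 x) + tml B (@pair_r F G) (tml B p2 x) = x.
  have aM M N (f : {linear M -> N}) := tens_map_additive (idfun : {linear B -> B}) f.
  move: {+}x; apply: tens_morph_eq => [y z|//|b [u v]].
    by rewrite !aM opprD addrACA.
  have [_ tDr _] := tens_balanced B (F * G)%type.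
  rewrite !tens_mapE -tDr; congr tens.
  by rewrite /pair_l /pair_r /= /GRing.add /= /add_pair /= addr0 add0r.
by rewrite z1 z2 !(zmorph0 (tens_map_additive _ _)) addr0.
Qed.

(** The free cover of C lifts to B, and the two covers together give a cover of
    B by F x (free cover of C), whose kernel is an extension of the two
    kernels. *)
Lemma horseshoe_step A B C (a : {linear A -> B}) (b : {linear B -> C})
    A1 F (f : {linear A1 -> F}) (e : {linear F -> A}) :
  flat_left F -> ses a b -> ses f e ->
  exists (B1 P : lmodType R) (u : {linear B1 -> P}) (v : {linear P -> B})
    (a1 : {linear A1 -> B1}) (b1 : {linear B1 -> syzygy C}),
    [/\ flat_left P, ses u v & ses a1 b1].
Proof.
move=> Ff [ai ab bs] [fi fe es].
have [pi pe ps] := cover_ses C.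
have [h hE] := free_projective (cover_map C) bs.
pose P : lmodType R := (F * free_cover C)%type.
pose t : {linear P -> B} := (a \o (e \o fst)) \+ (h \o snd).
have tE x y : t (x, y) = a (e x) + h y by [].
have ts : surjective t.
  move=> y; have [z zE] := ps (b y).
  have /ab[x xE] : b (y - h z) = 0 by rewrite linearB hE zE subrr.
  have [w wE] := es x; exists (w, z).
  by rewrite tE wE xE subrK.
have uv := ker_ses ts.
pose u := @ker_in _ _ _ t.
have ui : injective u by case: uv.
(* The equation that defines the kernel of t, in coordinates. *)
have tu x : a (e (u x).1) + h (u x).2 = 0.
  by rewrite -tE -surjective_pairing; apply/ker_in_exact; exists x.
have [x|a1 a1E] := linear_lift (i := u) (g := @pair_l F (free_cover C) \o f) ui.
  apply/ker_in_exact; rewrite [LHS](tE (f x) 0).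
  by rewrite (exact0 _ fe) !linear0 addr0.
have [x|b1 b1E] := linear_lift (g := snd \o u : {linear ker t -> free_cover C}) pi.
  apply/pe; rewrite -hE; have /(congr1 b) := tu x.
  by rewrite linearD (exact0 _ ab) add0r linear0.
exists (ker t), P, u, t, a1, b1; split=> //.
  by apply: flat_left_prod => //; exact: cover_flat_left.
split=> [x y xy|x|y].
- by have := a1E x; rewrite xy a1E => -[] /fi.
- split=> [bx|[z <-]]; last first.
    by apply: pi; rewrite b1E /= a1E linear0.
  have : (u x).2 = 0 by rewrite -[LHS]/((snd \o u) x) -b1E bx linear0.
  move: (tu x); case uE : (u x) => [y z] /= + z0.
  rewrite z0 linear0 addr0 -(linear0 a) => /ai/fe[w wE].
  by exists w; apply: ui; rewrite [LHS]a1E [RHS]uE z0 /= wE.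
have /ab[x xE] : b (h (syzygy_in C y)) = 0 by rewrite hE (exact0 _ pe).
have [w wE] := es x.
have /ker_in_exact[z zE] : t (- w, syzygy_in C y) = 0.
  by rewrite tE !linearN wE xE addNr.
by exists z; apply: pi; rewrite b1E /= -/u /u zE.
Qed.

Lemma horseshoe s A B C (a : {linear A -> B}) (b : {linear B -> C}) K :
  ses a b -> res (@flat_left R) (eq^~ K) s A ->
  exists Y : lmodType R, res (@flat_left R) (eq^~ Y) s B /\
  exists (f : {linear K -> Y}) (g : {linear Y -> iter s (@syzygy R) C}), ses f g.
Proof.
elim: s A B C a b => [|s IH] A B C a b ab.
  by move=> /= <-; exists B; split=> //; exists a, b.
move=> [A1 [F [f [e [Ff fe rA]]]]].
have [B1 [P [u [v [a1 [b1 [Pf uv ab1]]]]]]] := horseshoe_step Ff ab fe.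
have [Y [rY [k [l kl]]]] := IH _ _ _ _ _ ab1 rA.
exists Y; split; first by exists B1, P, u, v.
by rewrite iterSr; exists k, l.
Qed.

Lemma res_eq_tor (B : lmodType R^c) s M K : res (@flat_left R) (eq^~ K) s M ->
  tor1_eq0 B (iter s (@syzygy R) M) -> tor1_eq0 B K.
Proof.
elim: s M => [|s IH] M /=; first by move=> ->.
move=> [K1 [F [f [e [Ff fe rK]]]]] tM; apply: (IH _ rK).
exact/(tor1_syzygyS _ _ Ff fe).
Qed.

Lemma res_eq_syzygy s M K : res (@flat_left R) (eq^~ K) s M ->
  res (@flat_left R) (eq^~ (syzygy K)) s.+1 M.
Proof.
elim: s M => [|s IH] M.
  move=> /= ->; exists (syzygy K), (free_cover K), (syzygy_in K), (cover_map K).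
  by split=> //; [exact: cover_flat_left | exact: cover_ses].
by move=> [K1 [F [f [e [Ff fe /IH rK]]]]]; exists K1, F, f, e.
Qed.

End Horseshoe.

Section Main.
Variables (R : pzRingType) (BB : modclass R^c).

(** The class P of all s-th syzygies satisfies [GF_coind]: the horseshoe over
    0 -> N -> I -> C -> 0 embeds an s-th syzygy of N in a flat module with cokernel
    an s-th syzygy of C. *)
Lemma syzygy_GF (s : nat) :
  (forall B, BB B -> (fd_right B <= (Posz s)%:E)%E) ->
  (forall I : lmodType R, injective_module I ->
     flat_left (iter s (@syzygy R) I)) ->
  forall M : lmodType R, GF BB (iter s (@syzygy R) M).
Proof.
move=> fdB flI M.
pose P K := exists M, res (@flat_left R) (eq^~ K) s M.
have PM N : P (iter s (@syzygy R) N).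
  by exists N; apply: res_syzygy => //; exact: cover_flat_left.
apply: (@GF_coind _ _ P) => // K [N rK].
- move=> B BBB; apply: (res_eq_tor rK).
  by move: N {rK}; apply/fd_right_tor; exact: fdB.
- have [N1 [F [f [e [Ff fe rN1]]]]] := res_eq_syzygy rK.
  have PK : P (syzygy K) by exists N1.
  by split; exact: (LeftStep PK (@cover_flat_left _ K) (cover_ses K)).
have [I [i [Iinj ii]]] := enough_injectives N.
have [Y [rY [f [g fg]]]] := horseshoe (coker_ses ii) rK.
have Yf : flat_left Y.
  apply/flat_left_tor => B; apply: (res_eq_tor rY).
  by move: B; apply/flat_left_tor; exact: flI.
by split; exact: (RightStep (PM _) Yf fg).
Qed.

(** The bound [d <= j] is there because the length of the resolution depends on M,
    while a single [j] is needed for all M. *)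
Lemma res_GF_tor d j M B : BB B -> (d <= j)%N -> res (GF BB) (GF BB) d M ->
  tor1_eq0 B (iter j (@syzygy R) M).
Proof.
move=> BBB; elim: d j M => [|d IH] j M; first by move=> _ /GF_left_GF; exact: left_GF_tor.
case: j => // j dj [K [G [f [e [/GF_left_GF GG fe /(IH _ _ dj) tK]]]]].
have := left_GF_tor (j := j.+1) BBB GG.
rewrite !tor1_iter_syzygy in tK * => tG.
exact: tor1_extension fe tK tG.
Qed.

End Main.

Lemma resdim_ge0 (R : pzRingType) (C : modclass R) M : (0 <= resdim C M)%E.
Proof.
rewrite /resdim; have [[j [_ _ ->]]|[_ ->]] := dim_infP (has_resolution C ^~ M) => //.
Qed.

Lemma nat_of_fin (x : \bar int) (m : nat) : (0 <= x)%E -> (x <= (Posz m)%:E)%E ->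
  exists s : nat, x = (Posz s)%:E%E.
Proof.
case: x => [[s|s]||] //; first by exists s.
Qed.

Lemma FPinj_mono (R : pzRingType) (k n : nat) (E : lmodType R) :
  (k <= n)%N -> FPinj k E -> FPinj n E.
Proof.
move=> kn Ek M [P [d [e [fgP es ex0 ex]]]]; apply: Ek; exists P, d, e; split=> //.
- by move=> i ik; apply/fgP/(leq_trans ik).
- by move=> k0; apply: ex0; exact: leq_trans kn.
by move=> i ik; apply: ex; exact: leq_trans kn.
Qed.

Theorem corollary3p16 (R : pzRingType) (n : nat)
    (hR : gorenstein_coherent R n) (k : nat) (hk : (k <= n)%N) :
  lwGgl (@FPinj R^c k) \is a fin_num /\
  lwGgl (@FPinj R^c k) = dim_sup (@fd_right R) (@FPinj R^c k).
Proof.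
case: hR => _ _ [m [fdl fdr]].
pose BB := @FPinj R^c k.
(* The class of FP_k-injective modules is nonempty, so its supremum is genuine. *)
have [E0 [_ [/(@injective_FPinj _ k) BE0 _]]] := enough_injectives (zero_module R^c).
have [ubr lubr] := @dim_supP R^c (@fd_right R) BB (ex_intro _ _ BE0) (@resdim_ge0 _ _).
have [ubg lubg] := @dim_supP R (Gfd BB) (fun _ => True)
  (ex_intro _ (zero_module R) Logic.I) (@resdim_ge0 _ _).
have [s sE] : exists s : nat, dim_sup (@fd_right R) BB = (Posz s)%:E%E.
  apply: (@nat_of_fin _ m); first exact: le_trans (resdim_ge0 _ _) (ubr _ BE0).
  by apply: lubr => B BB_B; apply: fdr; exact: FPinj_mono BB_B.
rewrite sE in ubr lubr.
have flI (I : lmodType R) : injective_module I -> flat_left (iter s (@syzygy R) I).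
  move=> Iinj; apply/flat_left_tor; apply: (@fd_left_injective _ s m) => [E Einj|].
    by apply: ubr; exact: injective_FPinj.
  by apply/fd_left_tor/fdl; exact: injective_FPinj.
have Gs : (lwGgl BB <= (Posz s)%:E)%E.
  apply: lubg => M _; apply/dim_inf_le; exists s => //; apply: res_has_resolution.
  apply: res_syzygy => [X|]; first exact/flat_GF/cover_flat_left.
  exact: syzygy_GF.
have [d dE] : exists d : nat, lwGgl BB = (Posz d)%:E%E.
  apply: nat_of_fin Gs.
  exact: le_trans (resdim_ge0 _ _) (ubg (zero_module R) Logic.I).
rewrite -/BB dE; split=> //; rewrite sE; apply/eqP; rewrite eq_le -{1}dE Gs /=.
apply: lubr => B BB_B; apply/fd_right_tor => M.
have : (Gfd BB M <= (Posz d)%:E)%E by rewrite -dE; exact: ubg.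
by move=> /dim_inf_le[i id /(has_resolution_res (@GF_iso _ _))]; exact: res_GF_tor.
Qed.
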